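(* Consider the dNLS lattice with saturable potential $h(x)=(1+x)^{-1}$. For $n\ge16$, let $\mu_-\in(0,1)$ and $\mu_+\in(1,\infty)$ be the two solutions of $-\mu^2(1+\mu^2)^{-2}=\delta_1$, where $\delta_1=2\left(\sin^2(\zeta/2)-\sin^2\zeta\right)/\cos\zeta$ and $\zeta=2\pi/n$. Then from each of the amplitudes $\mu_-$ and $\mu_+$ there is a bifurcation of relative equilibria (from the rotating wave $\bar a$) with maximal symmetry $\tilde D_1$.
   Context: dNLS lattice: $i\dot q_j=h(|q_j|^2)q_j+(q_{j+1}-2q_j+q_{j-1})$, $q_j\in\mathbb{C}$, $q_{j+n}=q_j$. Writing $q_j=\mu e^{i\omega t}x_j$ with $x_j$ constant, $x=(x_1,\dots,x_n)\in\mathbb{C}^n=\mathbb{R}^{2n}$ is a relative equilibrium when $$\omega x_j+h(|\mu x_j|^2)x_j+(x_{j+1}-2x_j+x_{j-1})=0\quad(j=1,\dots,n),\qquad \omega=4\sin^2(\zeta/2)-h(\mu^2),$$ indices modulo $n$. With this $\omega$ the rotating wave $\bar a=(e^{i\zeta},e^{2i\zeta},\dots,e^{ni\zeta})$ is a relative equilibrium for every $\mu$. For $d$ dividing $n$, $\tilde D_d$ is the group generated by $x\mapsto y$, $y_j=e^{-2\pi i/d}x_{j+n/d}$, and $x\mapsto y$, $y_j=\bar x_{n-j}$; in particular $\tilde D_1$ is generated by the second map. $E_d$ is the fixed-point space of $\tilde D_d$. A bifurcation from $\mu_*$ with maximal symmetry $\tilde D_1$ means: there are relative equilibria $(x,\mu)$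 with $x\in E_1\setminus\{\bar a\}$ arbitrarily close to $(\bar a,\mu_* )$, and such relative equilibria near $(\bar a,\mu_* )$ do not belong to $E_p$ for any $p>1$ dividing $n$. *)

(* Defs.v *)
From HB Require Import structures.
From mathcomp Require Export all_boot all_order all_algebra.
From mathcomp Require Export complex.
From mathcomp Require Export all_classical all_reals all_analysis.

Set Implicit Arguments.
Unset Strict Implicit.
Unset Printing Implicit Defensive.

Import Order.TTheory GRing.Theory Num.Theory.

Local Open Scope ring_scope.
Local Open Scope complex_scope.

Definition cis (R : realType) (t : R) : R[i] := cos t +i* sin t.

Definition zeta (R : realType) (n : nat) : R := 2 * pi / n%:R.

(* C^n, with site indices taken modulo n: the site usually labelled n is 0,
   and x_{n-j} is x (- j).  'Z_n is Z/n only when 1 < n. *)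
Definition state (R : realType) (n : nat) : Type := {ffun 'Z_n -> R[i]}.

Definition frequency (R : realType) (h : R -> R) (n : nat) (mu : R) : R :=
  4 * sin (zeta R n / 2) ^+ 2 - h (mu ^+ 2).

Definition relative_equilibrium (R : realType) (h : R -> R) (n : nat)
    (x : state R n) (mu : R) : Prop :=
  forall j : 'Z_n,
    (frequency h n mu)%:C * x j
    + (h (Normc.normc (mu%:C * x j) ^+ 2))%:C * x j
    + (x (j + 1) - 2 * x j + x (j - 1)) = 0.

Definition rotating_wave (R : realType) (n : nat) : state R n :=
  [ffun j : 'Z_n => cis ((nat_of_ord j)%:R * zeta R n)].

Definition twisted_shift (R : realType) (n d : nat) (x : state R n) :
    state R n :=
  [ffun j : 'Z_n => cis (- (2 * pi / d%:R)) * x (j + (n %/ d)%:R)].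

Definition reflection (R : realType) (n : nat) (x : state R n) : state R n :=
  [ffun j : 'Z_n => (x (- j))^*].

(* The generated group; both generators are invertible when 0 < d divides n. *)
Inductive Dtilde (R : realType) (n d : nat) :
    (state R n -> state R n) -> Prop :=
| Dtilde_shift : Dtilde d (@twisted_shift R n d)
| Dtilde_reflection : Dtilde d (@reflection R n)
| Dtilde_id : Dtilde d id
| Dtilde_comp f g : Dtilde d f -> Dtilde d g -> Dtilde d (f \o g)
| Dtilde_inv f g : Dtilde d f -> cancel f g -> cancel g f -> Dtilde d g.

Definition Efix (R : realType) (n d : nat) (x : state R n) : Prop :=
  forall g : state R n -> state R n, Dtilde d g -> g x = x.

(* The open box of radius eps around the point (rotating wave, mu0) of
   C^n x R. *)
Definition near_wave (R : realType) (n : nat) (mu0 eps : R)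
    (x : state R n) (mu : R) : Prop :=
  (forall j : 'Z_n, Normc.normc (x j - rotating_wave R n j) < eps) /\
  `|mu - mu0| < eps.

Definition nontrivial_symmetric_equilibrium (R : realType) (h : R -> R) (n : nat)
    (x : state R n) (mu : R) : Prop :=
  [/\ relative_equilibrium h x mu, Efix 1 x & x <> rotating_wave R n].

Definition bifurcation_with_maximal_symmetry_D1 (R : realType) (h : R -> R)
    (n : nat) (mu0 : R) : Prop :=
  (forall eps : R, 0 < eps ->
    exists (x : state R n) (mu : R),
      nontrivial_symmetric_equilibrium h x mu /\ near_wave mu0 eps x mu) /\
  (exists2 eps : R, 0 < eps &
    forall (x : state R n) (mu : R),
      nontrivial_symmetric_equilibrium h x mu -> near_wave mu0 eps x mu ->
      forall p : nat, (1 < p)%N -> (p %| n)%N -> ~ Efix p x).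

Definition saturable (R : realType) (x : R) : R := (1 + x)^-1.

Definition delta1 (R : realType) (n : nat) : R :=
  2 * (sin (zeta R n / 2) ^+ 2 - sin (zeta R n) ^+ 2) / cos (zeta R n).

(* Main.v *)
Require Import Defs.
From mathcomp Require Import ring lra zify.

(** Write a state as x_j = X_j + i Y_j. The equation at site j says that
    x_{j+1} + x_{j-1} is a real multiple of x_j, so a relative equilibrium is an
    orbit of a reversible map of pairs (x_{j-1}, x_j), and one in E_1 (x_{-j} is
    the conjugate of x_j) is determined by the real number x_0 and by Im x_1,
    because the equation at site 0 then gives Re x_1. Conversely the orbit of
    such data closes up to an n-periodic symmetric state as soon as it is
    symmetric about n/2 as well, that is x_l = conj x_k for one pair l + k = n
    with l - k equal to 1 or 2 (mirror_orbit). The problem is thus two real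
    equations F1 = F2 = 0 in two unknowns (al, be) and the amplitude m, with the
    rotating wave as the zero al = be = 0 for every m.

    For x_j = e^{ijz} (1 + p_j + i q_j), z = zeta, the linearisation at the wave
    has two explicit families of solutions with the symmetry about 0: a ripple
    p_j = cos (j phi), where cos phi = 2 cos^2 z - 1 - kappa(m) cos z and
    kappa(m) = m^2 h'(m^2), and a drift p_j = 1, q_j proportional to j. With al
    along the first and be along the second, the Jacobian of (F1, F2) is
    triangular. Its entry for the drift does not vanish, and its entry for the
    ripple, cos (l phi) - cos (k phi), is proportional to sin (n phi / 2). This
    changes sign exactly when phi crosses zeta, that is when kappa(m) crosses
    delta1 (gap_sign, kappa_crossing), which it does transversally at each of
    the two amplitudes. One equation is then solved for be by monotonicity, and
    the other by the intermediate value theorem in m, for each small al > 0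
    (bifurcation_simple).

    For the maximality of the symmetry, a state in E_1 and E_q satisfies the
    analogous pair of equations with (l, k) = (n / q, 0). Its ripple entry at the
    bifurcation point is cos (2 pi / q) - 1, which is nonzero, so the Jacobian is
    invertible and the wave is locally the only solution (isolated_zero,
    no_higher_symmetry).

    Because h is rational, the orbit depends on (al, be, m) rationally and
    without poles. Differentiability is handled by writing differences as
    combinations of the differences of al and be with continuous coefficients
    (sloped), a form stable under sums, products and inverses. The hypothesis
    n >= 16 gives cos zeta > 23/25, hence delta1 > -1/4, the minimum of kappa. *)

Set Implicit Arguments.
Unset Strict Implicit.
Unset Printing Implicit Defensive.

Import Order.TTheory GRing.Theory Num.Theory.
Import numFieldNormedType.Exports.

Local Open Scope ring_scope.
Local Open Scope classical_set_scope.

(** * Functions with continuous slopes *)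

Section Slopes.
Variable R : realType.
Implicit Types (P : R -> Prop) (f : R * R * R -> R) (v a b phi : R -> R).

(** Strict differentiability in the first two of three variables, in Hadamard's
    form: continuous difference quotients g and h in each direction. The values
    v and partial derivatives a, b at the origin are functions of the third
    variable, and are prescribed only where P holds since the closed forms used
    for them below make sense only there. *)
Definition sloped P f v a b : Prop :=
  exists g h : (R * R) * (R * R) * R -> R,
  [/\ continuous f, continuous g, continuous h,
      forall (x y : R * R) m, f (x, m) - f (y, m) =
        g (x, y, m) * (x.1 - y.1) + h (x, y, m) * (x.2 - y.2)
    & forall m, P m -> [/\ f (0, 0, m) = v m, g ((0, 0), (0, 0), m) = a m
                         & h ((0, 0), (0, 0), m) = b m]].

Lemma continuous_fst (T U : topologicalType) : continuous (@fst T U).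
Proof. by move=> p; apply: cvg_fst. Qed.

Lemma continuous_snd (T U : topologicalType) : continuous (@snd T U).
Proof. by move=> p; apply: cvg_snd. Qed.

Lemma continuous_compT (S T U : topologicalType) (k : T -> U) (f : S -> T) :
  continuous k -> continuous f -> continuous (fun x => k (f x)).
Proof. by move=> ck cf x; apply: (@continuous_comp _ _ _ f k); [exact: cf|exact: ck]. Qed.

Lemma continuous_pair (S T U : topologicalType) (f : S -> T) (k : S -> U) :
  continuous f -> continuous k -> continuous (fun x => (f x, k x)).
Proof. by move=> cf ck x; apply: cvg_pair; [exact: cf|exact: ck]. Qed.

Lemma continuous_left f : continuous f ->
  continuous (fun q : (R * R) * (R * R) * R => f (q.1.1, q.2)).
Proof.
move=> cf; apply: continuous_compT cf _; apply: continuous_pair.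
  apply: (@continuous_compT _ _ _ fst fst); exact: continuous_fst.
exact: continuous_snd.
Qed.

Lemma continuous_right f : continuous f ->
  continuous (fun q : (R * R) * (R * R) * R => f (q.1.2, q.2)).
Proof.
move=> cf; apply: continuous_compT cf _; apply: continuous_pair.
  apply: (@continuous_compT _ _ _ snd fst).
    exact: continuous_snd.
  exact: continuous_fst.
exact: continuous_snd.
Qed.

Lemma sloped_ext P f f' v v' a a' b b' : sloped P f v a b ->
  f =1 f' ->
  (forall m, P m -> [/\ v m = v' m, a m = a' m & b m = b' m]) ->
  sloped P f' v' a' b'.
Proof.
move=> [g [h [cf cg ch e d]]] /funext <- E; exists g, h; split => // m Pm.
by case: (d _ Pm) (E _ Pm) => -> -> -> [-> -> ->].
Qed.

Lemma sloped_param P phi : continuous phi ->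
  sloped P (fun p => phi p.2) phi (fun=> 0) (fun=> 0).
Proof.
move=> cphi; exists (fun=> 0), (fun=> 0); split => //=.
- apply: continuous_compT cphi _; exact: continuous_snd.
- by move=> q; apply: cvg_cst.
- by move=> q; apply: cvg_cst.
- by move=> x y m; ring.
Qed.

Lemma sloped_cst P (k : R) : sloped P (fun=> k) (fun=> k) (fun=> 0) (fun=> 0).
Proof. by apply: (@sloped_param P (fun=> k)) => x; apply: cvg_cst. Qed.

Lemma sloped_fst P : sloped P (fun p => p.1.1) (fun=> 0) (fun=> 1) (fun=> 0).
Proof.
exists (fun=> 1), (fun=> 0); split => //=.
- apply: (@continuous_compT _ _ _ fst fst); exact: continuous_fst.
- by move=> q; apply: cvg_cst.
- by move=> q; apply: cvg_cst.
- by move=> x y m; ring.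
Qed.

Lemma sloped_snd P : sloped P (fun p => p.1.2) (fun=> 0) (fun=> 0) (fun=> 1).
Proof.
exists (fun=> 0), (fun=> 1); split => //=.
- apply: (@continuous_compT _ _ _ snd fst).
    exact: continuous_snd.
  exact: continuous_fst.
- by move=> q; apply: cvg_cst.
- by move=> q; apply: cvg_cst.
- by move=> x y m; ring.
Qed.

Lemma slopedD P f v a b f' v' a' b' :
  sloped P f v a b -> sloped P f' v' a' b' ->
  sloped P (fun p => f p + f' p) (fun m => v m + v' m)
    (fun m => a m + a' m) (fun m => b m + b' m).
Proof.
move=> [g [h [cf cg ch e d]]] [g' [h' [cf' cg' ch' e' d']]].
exists (fun q => g q + g' q), (fun q => h q + h' q); split.
- by move=> p; apply: cvgD; [apply: cf|apply: cf'].
- by move=> p; apply: cvgD; [apply: cg|apply: cg'].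
- by move=> p; apply: cvgD; [apply: ch|apply: ch'].
- by move=> x y m /=; rewrite opprD addrACA e e'; ring.
- by move=> m Pm; case: (d _ Pm) (d' _ Pm) => -> -> -> [-> -> ->].
Qed.

Lemma slopedM P f v a b f' v' a' b' :
  sloped P f v a b -> sloped P f' v' a' b' ->
  sloped P (fun p => f p * f' p) (fun m => v m * v' m)
    (fun m => v m * a' m + v' m * a m) (fun m => v m * b' m + v' m * b m).
Proof.
move=> [g [h [cf cg ch e d]]] [g' [h' [cf' cg' ch' e' d']]].
have cl := continuous_left cf; have cr := continuous_right cf'.
exists (fun q => f (q.1.1, q.2) * g' q + f' (q.1.2, q.2) * g q),
       (fun q => f (q.1.1, q.2) * h' q + f' (q.1.2, q.2) * h q); split.
- by move=> p; apply: cvgM; [apply: cf|apply: cf'].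
- move=> p; apply: cvgD; apply: cvgM;
    by [exact: cl|exact: cr|exact: cg|exact: cg'].
- move=> p; apply: cvgD; apply: cvgM;
    by [exact: cl|exact: cr|exact: ch|exact: ch'].
- move=> x y m /=.
  rewrite [LHS](_ : _ = f (x, m) * (f' (x, m) - f' (y, m)) +
     f' (y, m) * (f (x, m) - f (y, m))); last by ring.
  by rewrite e e'; ring.
- by move=> m Pm /=; case: (d _ Pm) (d' _ Pm) => -> -> -> [-> -> ->].
Qed.

Lemma slopedV P f v a b : (forall p, f p != 0) -> sloped P f v a b ->
  sloped P (fun p => (f p)^-1) (fun m => (v m)^-1)
    (fun m => - a m / v m ^+ 2) (fun m => - b m / v m ^+ 2).
Proof.
move=> f0 [g [h [cf cg ch e d]]].
have cl := continuous_left cf; have cr := continuous_right cf.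
have ci : continuous (fun q : (R * R) * (R * R) * R =>
    (f (q.1.1, q.2) * f (q.1.2, q.2))^-1).
  move=> q; apply: cvgV; first by rewrite mulf_neq0.
  by apply: cvgM; [exact: cl|exact: cr].
exists (fun q => - g q * (f (q.1.1, q.2) * f (q.1.2, q.2))^-1),
       (fun q => - h q * (f (q.1.1, q.2) * f (q.1.2, q.2))^-1); split.
- by move=> p; apply: cvgV => //; exact: cf.
- by move=> q; apply: cvgM; [apply: cvgN; exact: cg|exact: ci].
- by move=> q; apply: cvgM; [apply: cvgN; exact: ch|exact: ci].
- move=> x y m /=.
  rewrite [LHS](_ : _ = - (f (x, m) - f (y, m)) / (f (x, m) * f (y, m))).
    by rewrite e; ring.
  by field; rewrite !f0.
- by move=> m Pm /=; case: (d _ Pm) => -> -> ->; rewrite expr2.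
Qed.

Lemma slopedN P f v a b : sloped P f v a b ->
  sloped P (fun p => - f p) (fun m => - v m) (fun m => - a m) (fun m => - b m).
Proof.
move=> sf; apply: sloped_ext (slopedM (sloped_cst P (-1)) sf) _ _ => /=.
  by move=> p; ring.
by move=> m _; split; ring.
Qed.

End Slopes.

(** * Bifurcation from a line of zeros *)

Section Bif.
Variable R : realType.
Implicit Types (P : R -> Prop) (F : R * R * R -> R).

Lemma continuous_ball (T : pseudoMetricType R) (k : T -> R) (p : T) (e : R) :
  {for p, continuous k} -> 0 < e ->
  exists2 d : R, 0 < d & forall q, ball p d q -> `|k q - k p| < e.
Proof.
move=> /cvgrPdist_lt ck e0; have /nbhs_ballP [d /= d0 H] := ck _ e0.
by exists d => // q /H /=; rewrite distrC.
Qed.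

Lemma continuous_box (k : (R * R) * (R * R) * R -> R) (m0 e : R) :
  continuous k -> 0 < e ->
  exists2 d : R, 0 < d & forall x1 x2 y1 y2 m : R,
    `|x1| < d -> `|x2| < d -> `|y1| < d -> `|y2| < d -> `|m - m0| < d ->
    `|k ((x1, x2), (y1, y2), m) - k ((0, 0), (0, 0), m0)| < e.
Proof.
move=> ck e0; have [d d0 H] := continuous_ball (ck ((0, 0), (0, 0), m0)) e0.
exists d => // x1 x2 y1 y2 m h1 h2 h3 h4 h5; apply: H.
by split; [split; split|] => /=; rewrite /ball /= ?sub0r ?normrN // distrC.
Qed.

(** Monotonicity makes the zero unique, the intermediate value theorem makes it
    exist, and it is continuous in m because the signs of F at B m - e and
    B m + e persist when m moves slightly. *)
Lemma monotone_implicit (F : R * R -> R) (r m0 d : R) :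
  continuous F -> 0 < r ->
  (forall m, `|m - m0| < d -> F (- r, m) < 0 < F (r, m)) ->
  (forall m b b' : R, `|m - m0| < d -> `|b| <= 2 * r -> `|b'| <= 2 * r -> b < b' ->
     F (b, m) < F (b', m)) ->
  exists B : R -> R, forall m, `|m - m0| < d ->
    [/\ `|B m| < r, F (B m, m) = 0 & {for m, continuous B}].
Proof.
move=> cF r0 sgn mono.
have cb m : continuous (fun b => F (b, m)).
  apply: continuous_compT cF _; apply: continuous_pair => x //; exact: cvg_cst.
have cm b : continuous (fun m => F (b, m)).
  apply: continuous_compT cF _; apply: continuous_pair => x //; exact: cvg_cst.
have ex m : exists b, `|m - m0| < d -> `|b| < r /\ F (b, m) = 0.
  have [md|md] := ltP; last by exists 0.
  have /andP[s1 s2] := sgn _ md.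
  have [||b] := @IVT R (fun b => F (b, m)) (- r) r 0 _ (continuous_subspaceT (cb m)).
  - lra.
  - by rewrite ge_min le_max !(ltW s1) !(ltW s2) /= orbT.
  rewrite in_itv /= => /andP[b1 b2] Fb; exists b => _; split=> //.
  rewrite ltr_norml; apply/andP; split; rewrite lt_neqAle ?b1 ?b2 andbT.
    by apply: contraTneq s1 => ->; rewrite Fb ltxx.
  by apply: contraTneq s2 => <-; rewrite Fb ltxx.
have {ex} [B HB] := choice ex.
exists B => m md; have [Br FB] := HB _ md; split=> //.
apply/cvgrPdist_lt => e e0.
pose e' := Num.min (e / 2) r.
have e'0 : 0 < e' by rewrite lt_min divr_gt0.
have e'r : e' <= r by rewrite ge_min lexx orbT.
have e'e : e' < e by rewrite gt_min ltr_pdivrMr // ltr_pMr // ltr1n.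
move: Br; rewrite ltr_norml => /andP[Br1 Br2].
have lt b b' m' : `|m' - m0| < d -> `|b| <= 2 * r -> `|b'| <= 2 * r ->
    F (b, m') < F (b', m') -> b < b'.
  move=> h1 h2 h3; case: (ltrgtP b b') => // [h|->]; last by rewrite ltxx.
  by move=> /lt_trans /(_ (mono _ _ _ h1 h3 h2 h)); rewrite ltxx.
have up : 0 < F (B m + e', m).
  by rewrite -FB mono // ?ler_norml; lra.
have dn : F (B m - e', m) < 0.
  by rewrite -[X in _ < X]FB mono // ?ler_norml; lra.
have near_md : \forall m' \near m, `|m' - m0| < d.
  have : continuous (fun x : R => `|x - m0|).
    by move=> x; apply: cvg_norm; apply: cvgB => //; apply: cvg_cst.
  by move=> /(_ m) /cvgr_lt /(_ _ md).
have near_up : \forall m' \near m, 0 < F (B m + e', m').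
  exact: (cvgr_gt _ (cm (B m + e') m) _ up).
have near_dn : \forall m' \near m, F (B m - e', m') < 0.
  exact: (cvgr_lt _ (cm (B m - e') m) _ dn).
near=> m'.
have md' : `|m' - m0| < d by near: m'.
have [Br' FB'] := HB _ md'.
move: Br'; rewrite ltr_norml => /andP[Br1' Br2'].
have h1 : B m' < B m + e'.
  apply: (lt _ _ m') => //; rewrite ?ler_norml; try lra.
  by rewrite FB'; near: m'.
have h2 : B m - e' < B m'.
  apply: (lt _ _ m') => //; rewrite ?ler_norml; try lra.
  by rewrite FB'; near: m'.
rewrite ltr_norml; lra.
Unshelve. all: by end_near.
Qed.

(** The slopes at (al, be) form a matrix that annihilates (al, be) and whose
    determinant is close to a1 m0 * b2 m0, which is nonzero. *)
Lemma isolated_zero P F1 F2 a1 a2 b2 (m0 : R) :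
  sloped P F1 (fun=> 0) a1 (fun=> 0) -> sloped P F2 (fun=> 0) a2 b2 ->
  (exists2 d : R, 0 < d & forall m, `|m - m0| < d -> P m) ->
  a1 m0 != 0 -> b2 m0 != 0 ->
  exists2 d : R, 0 < d & forall al be m, `|al| < d -> `|be| < d ->
    `|m - m0| < d -> F1 (al, be, m) = 0 -> F2 (al, be, m) = 0 ->
    al = 0 /\ be = 0.
Proof.
move=> [g1 [h1 [_ cg1 ch1 e1 d1]]] [g2 [h2 [_ cg2 ch2 e2 d2]]] [dP dP0 HP] a0 b0.
pose D q := g1 q * h2 q - h1 q * g2 q.
have cD : continuous D.
  by move=> q; apply: cvgB; apply: cvgM; by [exact: cg1|exact: ch1|exact: cg2|exact: ch2].
have Pm0 : P m0 by apply: HP; rewrite subrr normr0.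
have D0 : D ((0, 0), (0, 0), m0) = a1 m0 * b2 m0.
  by rewrite /D; case: (d1 _ Pm0) (d2 _ Pm0) => _ -> -> [_ -> ->]; rewrite mul0r subr0.
have n0 : 0 < `|a1 m0 * b2 m0| by rewrite normr_gt0 mulf_neq0.
have [d dd0 Hd] := continuous_box m0 cD n0.
exists (Num.min d dP); first by rewrite lt_min dd0.
move=> al be m; rewrite !lt_min => /andP[ha _] /andP[hb _] /andP[hm /HP Pm] E1 E2.
have z0 : `|0 : R| < d by rewrite normr0.
have := Hd _ _ _ _ _ ha hb z0 z0 hm; rewrite D0.
set q := (_, _, m) => Dq.
have Dn : D q != 0.
  by apply: contraTneq Dq => ->; rewrite sub0r normrN ltxx.
have := e1 (al, be) (0, 0) m; have := e2 (al, be) (0, 0) m.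
rewrite E1 E2; case: (d1 _ Pm) (d2 _ Pm) => -> _ _ [-> _ _].
rewrite -/q /= !subr0 => s2 s1.
have A0 : D q * al = 0.
  transitivity (h2 q * (g1 q * al + h1 q * be) - h1 q * (g2 q * al + h2 q * be)).
    by rewrite /D; ring.
  by rewrite -s1 -s2; ring.
have B0 : D q * be = 0.
  transitivity (g1 q * (g2 q * al + h2 q * be) - g2 q * (g1 q * al + h1 q * be)).
    by rewrite /D; ring.
  by rewrite -s1 -s2; ring.
by move/eqP: A0; move/eqP: B0; rewrite !mulf_eq0 (negbTE Dn) /= => /eqP-> /eqP->.
Qed.

(** Near the origin F is equivalent to a m * al in the cone |be| < al / 2, since
    its derivative along be vanishes. *)
Lemma leading_sign P F a (m : R) :
  sloped P F (fun=> 0) a (fun=> 0) -> P m -> a m != 0 ->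
  exists2 d : R, 0 < d & forall al be,
    0 < al < d -> `|be| < al / 2 -> 0 < a m * F (al, be, m).
Proof.
move=> [g [h [_ cg ch e v]]] Pm am0; have [F0 G0 H0] := v _ Pm.
have n0 : 0 < a m ^+ 2 / 2 by rewrite divr_gt0 // exprn_even_gt0.
have cag : continuous (fun q => a m * g q).
  by move=> q; apply: cvgM; [exact: cvg_cst|exact: cg].
have cah : continuous (fun q => a m * h q).
  by move=> q; apply: cvgM; [exact: cvg_cst|exact: ch].
have [dg dg0 Hg] := continuous_box m cag n0.
have [dh dh0 Hh] := continuous_box m cah n0.
exists (Num.min dg dh); first by rewrite lt_min dg0.
move=> al be /andP[al0]; rewrite lt_min => /andP[alg alh] beal.
have abs_al : `|al| = al by rewrite gtr0_norm.
have be_al : `|be| < al by apply: lt_trans beal _; rewrite ltr_pdivrMr // ltr_pMr // ltr1n.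
have z x : 0 < x -> `|0 : R| < x by rewrite normr0.
have zz x : 0 < x -> `|m - m| < x by rewrite subrr normr0.
have := e (al, be) (0, 0) m; rewrite F0 /= !subr0 => ->.
have := Hg al be 0 0 m; rewrite abs_al G0.
move=> /(_ alg (lt_trans be_al alg) (z _ dg0) (z _ dg0) (zz _ dg0)).
have := Hh al be 0 0 m; rewrite abs_al H0 mulr0 subr0.
move=> /(_ alh (lt_trans be_al alh) (z _ dh0) (z _ dh0) (zz _ dh0)).
move: (g _) (h _) => G H HH GG.
(* a G > a^2 / 2 and |a H| < a^2 / 2, so a (G al + H be) > a^2 al / 2 - a^2 al / 4. *)
have {}GG : a m ^+ 2 / 2 * al < a m * G * al.
  by rewrite ltr_pM2r //; move: GG; rewrite ltr_norml -expr2 => /andP[]; lra.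
have {}HH : `|a m * H * be| < a m ^+ 2 / 2 * (al / 2).
  by rewrite normrM; apply: ltr_pM.
have pos : 0 < a m ^+ 2 / 2 * (al / 2) by rewrite mulr_gt0 // divr_gt0.
move: HH; rewrite ltr_norml => /andP[HH _]; rewrite mulrDr !mulrA.
clear -GG HH pos; lra.
Qed.

(** F is strictly increasing in be, and as a is small near m0 its signs at
    be = - al / 2 and be = al / 2 are opposite: the zero lies in the cone. *)
Lemma zero_curve P F a b (m0 : R) :
  sloped P F (fun=> 0) a b ->
  (exists2 d : R, 0 < d & forall m, `|m - m0| < d -> P m) ->
  a m0 = 0 -> 0 < b m0 ->
  exists2 d : R, 0 < d & forall al, 0 < al < d ->
    exists B : R -> R, forall m, `|m - m0| < d ->
      [/\ `|B m| < al / 2, F (al, B m, m) = 0 & {for m, continuous B}].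
Proof.
move=> [g [h [cF cg ch e v]]] [dP dP0 HP] a0 b0.
have Pm0 : P m0 by apply: HP; rewrite subrr normr0.
have [_ G0 H0] := v _ Pm0.
have b8 : 0 < b m0 / 8 by rewrite divr_gt0.
have [dg dg0 Hg] := continuous_box m0 cg b8.
have [dh dh0 Hh] := continuous_box m0 ch b8.
exists (Num.min dP (Num.min dg dh)); first by rewrite !lt_min dP0 dg0.
move=> al; rewrite !lt_min => /andP[al0 /and3P[_ alg alh]].
have abs_al : `|al| = al by rewrite gtr0_norm.
have slopes x y m : `|x| <= al -> `|y| <= al -> `|m - m0| < Num.min dP (Num.min dg dh) ->
  b m0 / 2 < h ((al, x), (al, y), m).
  rewrite !lt_min => hx hy /and3P[_ _ mh].
  have := Hh al x al y m; rewrite abs_al H0.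
  move=> /(_ alh (le_lt_trans hx alh) alh (le_lt_trans hy alh) mh).
  rewrite ltr_norml => /andP[h1 _]; clear -h1 b0; lra.
have ends x m : `|x| <= al -> `|m - m0| < Num.min dP (Num.min dg dh) ->
  exists G H, [/\ F (al, x, m) = G * al + H * x, `|G| < b m0 / 8 & b m0 / 2 < H].
  rewrite !lt_min => hx /and3P[/HP Pm mg mh].
  have := e (al, x) (0, 0) m; have [-> _ _] := v _ Pm; rewrite /= !subr0 => ->.
  exists (g ((al, x), (0, 0), m)), (h ((al, x), (0, 0), m)); split=> //.
    have := Hg al x 0 0 m; rewrite abs_al normr0 G0 a0 subr0.
    by move=> /(_ alg (le_lt_trans hx alg) dg0 dg0 mg).
  have := Hh al x 0 0 m; rewrite abs_al normr0 H0.
  move=> /(_ alh (le_lt_trans hx alh) dh0 dh0 mh).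
  rewrite ltr_norml => /andP[h1 _]; clear -h1 b0; lra.
have cFal : continuous (fun q : R * R => F (al, q.1, q.2)).
  apply: continuous_compT cF _; apply: continuous_pair; last exact: continuous_snd.
  apply: continuous_pair; last exact: continuous_fst.
  by move=> x; apply: cvg_cst.
have al2 : 0 < al / 2 by rewrite divr_gt0.
have half : `|al / 2| <= al.
  by rewrite gtr0_norm // ler_pdivrMr // ler_pMr // ler1n.
apply: (@monotone_implicit _ (al / 2) m0 _ cFal al2) => [m md|m x y md].
  apply/andP; split=> /=.
    have [|G [H [-> G8 H2]]] := ends (- (al / 2)) m _ md; first by rewrite normrN.
    move: G8; rewrite ltr_norml => /andP[_ G8]; clear -G8 H2 al0 b0; nra.
  have [G [H [-> G8 H2]]] := ends (al / 2) m half md.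
  move: G8; rewrite ltr_norml => /andP[G8 _]; clear -G8 H2 al0 b0; nra.
rewrite [2 * _]mulrC divfK ?pnatr_eq0 // => hx hy xy /=.
have := e (al, y) (al, x) m; rewrite /= subrr mulr0 add0r => E.
have H2 := slopes _ _ _ hy hx md.
by rewrite -subr_gt0 E mulr_gt0 ?subr_gt0 // (lt_trans _ H2) // divr_gt0.
Qed.

(** Bifurcation through a sign change: F2 = 0 defines a curve be = B m, and along
    it F1 has the sign of a1 m, so it vanishes between m1 and m2. The cone
    |be| < al / 2 keeps the zero off the trivial line. *)
Lemma bifurcation_simple P F1 F2 a1 a2 b2 (m0 : R) :
  sloped P F1 (fun=> 0) a1 (fun=> 0) -> sloped P F2 (fun=> 0) a2 b2 ->
  (exists2 d : R, 0 < d & forall m, `|m - m0| < d -> P m) ->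
  a2 m0 = 0 -> 0 < b2 m0 ->
  (forall d, 0 < d -> exists m1 m2, [/\ m1 < m2, `|m1 - m0| < d,
     `|m2 - m0| < d & a1 m1 * a1 m2 < 0]) ->
  forall e, 0 < e -> exists al be m,
    [/\ 0 < al < e, `|be| < al / 2, `|m - m0| < e, F1 (al, be, m) = 0
      & F2 (al, be, m) = 0].
Proof.
move=> s1 s2 nP a20 b20 cross e e0.
have [dP dP0 HP] := nP; have [dB dB0 curve] := zero_curve s2 nP a20 b20.
have d0 : 0 < Num.min e (Num.min dP dB) by rewrite !lt_min e0 dP0.
have [m1 [m2 [m12]]] := cross _ d0; rewrite !lt_min.
move=> /and3P[m1e /HP Pm1 m1B] /and3P[m2e /HP Pm2 m2B] a12.
have a1m1 : a1 m1 != 0 by apply: contraTneq a12 => ->; rewrite mul0r ltxx.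
have a1m2 : a1 m2 != 0 by apply: contraTneq a12 => ->; rewrite mulr0 ltxx.
have [d1 d10 sign1] := leading_sign s1 Pm1 a1m1.
have [d2 d20 sign2] := leading_sign s1 Pm2 a1m2.
have [al al0 /andP[/andP[ale alB] /andP[al1 al2]]] : exists2 al, 0 < al &
    (al < e) && (al < dB) && ((al < d1) && (al < d2)).
  pose r := Num.min (Num.min e dB) (Num.min d1 d2).
  have r0 : 0 < r by rewrite !lt_min e0 dB0 d10.
  exists (r / 2); first by rewrite divr_gt0.
  by rewrite -!lt_min -/r ltr_pdivrMr // ltr_pMr // ltr1n.
have [|B HB] := curve al; first by rewrite al0.
have near_m0 x m : m1 <= m <= m2 -> `|m1 - m0| < x -> `|m2 - m0| < x -> `|m - m0| < x.
  move=> /andP[h1 h2]; rewrite !ltr_norml => /andP[h3 h4] /andP[h5 h6].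
  by apply/andP; split; clear -h1 h2 h3 h4 h5 h6; lra.
have cG m : m \in `[m1, m2]%R -> {for m, continuous (fun m => F1 (al, B m, m))}.
  rewrite in_itv /= => /near_m0 /(_ m1B m2B) /HB [_ _ cB].
  have [g [h [cF1 _ _ _ _]]] := s1.
  apply: (@continuous_comp _ _ _ (fun m => (al, B m, m)) F1); last exact: cF1.
  apply: (@cvg_pair _ _ _ (nbhs m) (nbhs (al, B m)) (nbhs m) _ _ _
    (fun m => (al, B m)) id) => //.
  apply: (@cvg_pair _ _ _ (nbhs m) (nbhs al) (nbhs (B m)) _ _ _ (fun=> al) B) => //.
  exact: cvg_cst.
have [B1 _ _] := HB _ m1B; have [B2 _ _] := HB _ m2B.
have {}sign1 : 0 < a1 m1 * F1 (al, B m1, m1) by apply: sign1 => //; rewrite al0.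
have {}sign2 : 0 < a1 m2 * F1 (al, B m2, m2) by apply: sign2 => //; rewrite al0.
have opposite : F1 (al, B m1, m1) * F1 (al, B m2, m2) < 0.
  by rewrite -(nmulr_rgt0 _ a12) mulrACA mulr_gt0.
have [||m mI Fm] := @IVT R (fun m => F1 (al, B m, m)) m1 m2 0 (ltW m12).
- by apply: continuous_in_subspaceT => m; rewrite inE; exact: cG.
- move: opposite; move: (F1 _) (F1 _) => w u uw; rewrite ge_min le_max.
  have [u0|u0|u0] := ltgtP u 0; last by rewrite u0 mul0r ltxx in uw.
    by rewrite nmulr_rlt0 // in uw; rewrite (ltW uw) ?orbT.
  by rewrite pmulr_rlt0 // in uw; rewrite (ltW uw) ?orbT.
rewrite in_itv /= in mI; have [Bm F2m _] := HB _ (near_m0 _ _ mI m1B m2B).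
exists al, (B m), m; split=> //; first by rewrite al0.
exact: near_m0 mI m1e m2e.
Qed.
End Bif.

(** * The lattice as a reversible map *)

Section Shooting.
Variable R : realType.
Implicit Types (z m t : R) (p : R * R * R) (j : nat).

(** m^2 h'(m^2), for h the saturable potential. *)
Definition kappa m : R := - m ^+ 2 * (1 + m ^+ 2) ^- 2.

(** The ratio (x_{j+1} + x_{j-1}) / x_j that the equation imposes, as
    2 - 4 sin^2 (z/2) = 2 cos z. *)
Definition coupling z m (w : R * R) : R :=
  2 * cos z + saturable (m ^+ 2) - saturable (m ^+ 2 * (w.1 ^+ 2 + w.2 ^+ 2)).

Definition advance z m (q : (R * R) * (R * R)) : (R * R) * (R * R) :=
  (q.2, (coupling z m q.2 * q.2.1 - q.1.1, coupling z m q.2 * q.2.2 - q.1.2)).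

(** The slope of Im x_1 that makes the second parameter below excite the drift
    alone, for every m and not only at the bifurcation: the Jacobian of the
    closing conditions is then triangular on a whole interval of amplitudes. *)
Definition tilt z m : R := sin z + kappa m * cos z / sin z.

(** A state in E_1 has x_0 real, and the equation at site 0 then fixes Re x_1;
    x_0 and Im x_1 are free. The first parameter moves them along (1, - sin z),
    which creates a pure ripple, and the second along (1, tilt). *)
Definition initial_pair z p : (R * R) * (R * R) :=
  let x0 := 1 + p.1.1 + p.1.2 in
  ((x0, 0), (coupling z p.2 (x0, 0) * x0 / 2,
             sin z - sin z * p.1.1 + tilt z p.2 * p.1.2)).

Definition orbit z p j : R * R := (iter j (advance z p.2) (initial_pair z p)).1.

Lemma orbit0 z p : orbit z p 0 = (1 + p.1.1 + p.1.2, 0).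
Proof. by []. Qed.

Lemma orbit1 z p : orbit z p 1 = (initial_pair z p).2.
Proof. by []. Qed.

Lemma orbitSS z p j : orbit z p j.+2 =
  (coupling z p.2 (orbit z p j.+1) * (orbit z p j.+1).1 - (orbit z p j).1,
   coupling z p.2 (orbit z p j.+1) * (orbit z p j.+1).2 - (orbit z p j).2).
Proof. by []. Qed.

Lemma onem2_gt0 m : 0 < 1 + m ^+ 2.
Proof. by rewrite ltr_pwDl // sqr_ge0. Qed.

Lemma onem2_neq0 m : 1 + m ^+ 2 != 0.
Proof. by rewrite gt_eqF // onem2_gt0. Qed.

Lemma continuous_onem2V : continuous (fun m : R => (1 + m ^+ 2)^-1).
Proof.
move=> m; apply: cvgV; first exact: onem2_neq0.
by apply: cvgD; [apply: cvg_cst|apply: (@cvgM _ _ (nbhs m) _ id id)].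
Qed.

Lemma continuous_kappa : continuous kappa.
Proof.
have -> : kappa =
    fun m => - (m * m) * ((1 + m ^+ 2)^-1 * (1 + m ^+ 2)^-1).
  by apply/funext => m; rewrite /kappa -expr2 -exprVn expr2.
move=> m; apply: cvgM; last by apply: cvgM; exact: continuous_onem2V.
by apply: cvgN; apply: cvgM.
Qed.

Lemma continuous_tilt z : continuous (tilt z).
Proof.
move=> m; apply: cvgD; first exact: cvg_cst.
apply: cvgM; last exact: cvg_cst.
by apply: cvgM; [exact: continuous_kappa|exact: cvg_cst].
Qed.

(** First-order expansion of X + i Y as e^{it} (1 + p + i q) in each direction. *)
Definition sloped_pair (P : R -> Prop) (X Y : R * R * R -> R) t
    (pa qa pb qb : R -> R) : Prop :=
  sloped P X (fun=> cos t) (fun m => cos t * pa m - sin t * qa m)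
    (fun m => cos t * pb m - sin t * qb m) /\
  sloped P Y (fun=> sin t) (fun m => sin t * pa m + cos t * qa m)
    (fun m => sin t * pb m + cos t * qb m).

(** The equation at one site, linearised at the rotating wave for the
    perturbation e^{ijz} (p_j + i q_j): its real and imaginary parts. *)
Definition linear_lattice z m (p0 q0 p1 q1 p2 q2 : R) : Prop :=
  cos z * (p2 + p0 - 2 * p1) - sin z * (q2 - q0) + 2 * kappa m * p1 = 0 /\
  cos z * (q2 + q0 - 2 * q1) + sin z * (p2 - p0) = 0.

Lemma sloped_coupling P z X Y t pa qa pb qb :
  sloped_pair P X Y t pa qa pb qb ->
  sloped P (fun p => coupling z p.2 (X p, Y p)) (fun=> 2 * cos z)
    (fun m => - 2 * kappa m * pa m) (fun m => - 2 * kappa m * pb m).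
Proof.
move=> [sX sY].
have sm2 : sloped P (fun p => p.2 ^+ 2) (fun m => m ^+ 2) (fun=> 0) (fun=> 0).
  apply: (@sloped_param R P (fun m => m ^+ 2)) => x.
  exact: (@cvgM _ _ (nbhs x) _ id id).
have s1 := slopedD (sloped_cst P 1)
  (slopedM sm2 (slopedD (slopedM sX sX) (slopedM sY sY))).
have n0 p : 1 + p.2 ^+ 2 * (X p * X p + Y p * Y p) != 0.
  by rewrite gt_eqF // ltr_pwDl // mulr_ge0 ?sqr_ge0 // addr_ge0 // -expr2 sqr_ge0.
have s2 := slopedV n0 s1.
have s3 := slopedD (slopedD (sloped_cst P (2 * cos z))
  (sloped_param P continuous_onem2V)) (slopedN s2).
apply: sloped_ext s3 _ _ => [p|m _] /=.
  by rewrite /coupling /saturable /= !expr2.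
have c1 : cos t * cos t + sin t * sin t = 1 by rewrite -!expr2 cos2Dsin2.
have m1 := onem2_neq0 m; rewrite c1 mulr1 /kappa -!mulrA.
have e a b : cos t * (cos t * a - sin t * b) + cos t * (cos t * a - sin t * b) +
   (sin t * (sin t * a + cos t * b) + sin t * (sin t * a + cos t * b)) = 2 * a.
  rewrite [LHS](_ : _ = 2 * a * (cos t * cos t + sin t * sin t)); last by ring.
  by rewrite c1 mulr1.
by split; rewrite ?e; field.
Qed.

Lemma sloped_advance P z (X0 Y0 X1 Y1 : R * R * R -> R) t
    (p0 q0 p1 q1 p2 q2 u0 w0 u1 w1 u2 w2 : R -> R) :
  sloped_pair P X0 Y0 (t - z) p0 q0 u0 w0 ->
  sloped_pair P X1 Y1 t p1 q1 u1 w1 ->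
  (forall m, P m -> linear_lattice z m (p0 m) (q0 m) (p1 m) (q1 m) (p2 m) (q2 m)) ->
  (forall m, P m -> linear_lattice z m (u0 m) (w0 m) (u1 m) (w1 m) (u2 m) (w2 m)) ->
  sloped_pair P (fun p => coupling z p.2 (X1 p, Y1 p) * X1 p - X0 p)
    (fun p => coupling z p.2 (X1 p, Y1 p) * Y1 p - Y0 p) (t + z) p2 q2 u2 w2.
Proof.
move=> [sX0 sY0] s1 La Lb; have [sX1 sY1] := s1; have sN := sloped_coupling z s1.
split.
  apply: sloped_ext (slopedD (slopedM sN sX1) (slopedN sX0)) _ _ => //= m Pm.
  rewrite !(cosD, sinD, cosN, sinN).
  have [e1 e2] := La _ Pm; have [e3 e4] := Lb _ Pm; split; first by ring.
    apply/eqP; rewrite -subr_eq0; apply/eqP; rewrite -[RHS](mulr0 (- cos t)) -e1.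
    by apply/eqP; rewrite -subr_eq0; apply/eqP; rewrite -[RHS](mulr0 (sin t)) -e2; ring.
  apply/eqP; rewrite -subr_eq0; apply/eqP; rewrite -[RHS](mulr0 (- cos t)) -e3.
  by apply/eqP; rewrite -subr_eq0; apply/eqP; rewrite -[RHS](mulr0 (sin t)) -e4; ring.
apply: sloped_ext (slopedD (slopedM sN sY1) (slopedN sY0)) _ _ => //= m Pm.
rewrite !(cosD, sinD, cosN, sinN).
have [e1 e2] := La _ Pm; have [e3 e4] := Lb _ Pm; split; first by ring.
  apply/eqP; rewrite -subr_eq0; apply/eqP; rewrite -[RHS](mulr0 (- sin t)) -e1.
  by apply/eqP; rewrite -subr_eq0; apply/eqP; rewrite -[RHS](mulr0 (- cos t)) -e2; ring.
apply/eqP; rewrite -subr_eq0; apply/eqP; rewrite -[RHS](mulr0 (- sin t)) -e3.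
by apply/eqP; rewrite -subr_eq0; apply/eqP; rewrite -[RHS](mulr0 (- cos t)) -e4; ring.
Qed.

(** The dispersion relation: ripples cos (j phi) solve the linearised equations. *)
Definition cosphi z m : R := 2 * cos z ^+ 2 - 1 - kappa m * cos z.
Definition phi z m : R := acos (cosphi z m).
(** phi is then a genuine angle in the open interval from 0 to pi. *)
Definition elliptic z m : Prop := -1 < cosphi z m < 1.

Definition drift_rate z m : R := ((1 - cosphi z m) / sin z - 2 * sin z) / cos z.
(** sin phi / (1 - cos phi) stands for cot (phi / 2), which avoids half angles. *)
Definition phase_ratio z m : R := sin z / cos z * (sin (phi z m) / (1 - cosphi z m)).

Definition ripple_amp z j m : R := cos (j%:R * phi z m).
Definition ripple_phase z j m : R := - phase_ratio z m * sin (j%:R * phi z m).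
Definition drift_phase z j m : R := j%:R * drift_rate z m.

Lemma cos_phiE z m : elliptic z m -> cos (phi z m) = cosphi z m.
Proof. by move=> /andP[h1 h2]; rewrite /phi acosK // in_itv /= !ltW. Qed.

Lemma linear_drift z m j : cos z != 0 -> sin z != 0 ->
  linear_lattice z m 1 (drift_phase z j m) 1 (drift_phase z j.+1 m) 1 (drift_phase z j.+2 m).
Proof.
move=> c0 s0; rewrite /linear_lattice /drift_phase -!natr1 /drift_rate /cosphi.
have s2 : sin z ^+ 2 = 1 - cos z ^+ 2 by rewrite sin2cos2.
split.
  apply/eqP; rewrite -(inj_eq (mulfI s0)) mulr0.
  rewrite [X in X == 0](_ : _ = 4 * (sin z ^+ 2 + cos z ^+ 2 - 1) * sin z / cos z); last first.
    by field; rewrite c0 s0.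
  by rewrite s2 subrK subrr mulr0 !mul0r.
by field; rewrite c0 s0.
Qed.

Lemma linear_ripple z m j : cos z != 0 -> sin z != 0 -> elliptic z m ->
  linear_lattice z m (ripple_amp z j m) (ripple_phase z j m) (ripple_amp z j.+1 m)
    (ripple_phase z j.+1 m) (ripple_amp z j.+2 m) (ripple_phase z j.+2 m).
Proof.
move=> c0 s0 el; rewrite /linear_lattice /ripple_amp /ripple_phase.
set th := j.+1%:R * phi z m.
have -> : j.+2%:R * phi z m = th + phi z m by rewrite /th -!natr1; ring.
have -> : j%:R * phi z m = th - phi z m by rewrite /th -!natr1; ring.
rewrite cosD cosB sinD sinB cos_phiE // /phase_ratio.
have s2 : sin z ^+ 2 = 1 - cos z ^+ 2 by rewrite sin2cos2.
have f2 : sin (phi z m) ^+ 2 = 1 - cosphi z m ^+ 2 by rewrite sin2cos2 cos_phiE.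
have k : kappa m = (2 * cos z ^+ 2 - 1 - cosphi z m) / cos z by rewrite /cosphi; field.
have d0 : 1 - cosphi z m != 0 by rewrite subr_eq0 eq_sym lt_eqF //; case/andP: el.
rewrite k; move: s2 f2; move: (sin z) (cos z) (sin (phi z m)) (cosphi z m) s0 c0 d0.
move=> s c f d s0 c0 d0 s2 f2; split.
  rewrite [LHS](_ : _ = cos th * (2 * c * (d - 1) +
      2 * (s ^+ 2 / c) * (f ^+ 2 / (1 - d)) + 2 * (2 * c ^+ 2 - 1 - d) / c)).
    rewrite s2 f2; apply/eqP; rewrite mulf_eq0; apply/orP; right; apply/eqP; field.
    by rewrite c0 d0.
  by field; rewrite c0 d0.
rewrite [LHS](_ : _ = - s * sin th * f * (2 * (d - 1) / (1 - d) + 2)); first by field.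
by field; rewrite c0 d0.
Qed.

(** Induction on the site: the linearised recurrence is second order, and both
    families solve it with the initial slopes that tilt was designed to match. *)
Lemma sloped_orbit z j : cos z != 0 -> sin z != 0 ->
  sloped_pair (elliptic z) (fun p => (orbit z p j).1) (fun p => (orbit z p j).2)
    (j%:R * z) (ripple_amp z j) (ripple_phase z j) (fun=> 1) (drift_phase z j).
Proof.
move=> c0 s0; set P := elliptic z.
pose S j := sloped_pair P (fun p => (orbit z p j).1) (fun p => (orbit z p j).2)
    (j%:R * z) (ripple_amp z j) (ripple_phase z j) (fun=> 1) (drift_phase z j).
have S0 : S 0%N.
  split=> /=.
    apply: sloped_ext (slopedD (slopedD (sloped_cst P 1) (sloped_fst P)) (sloped_snd P)) _ _ => //.
    move=> m _; rewrite /ripple_amp /ripple_phase /drift_phase !mul0r cos0 sin0; split; ring.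
  apply: sloped_ext (sloped_cst P 0) _ _ => // m _.
  rewrite /ripple_amp /ripple_phase /drift_phase !mul0r cos0 sin0; split; ring.
have k m : kappa m = (2 * cos z ^+ 2 - 1 - cosphi z m) / cos z by rewrite /cosphi; field.
have s2 : sin z ^+ 2 = 1 - cos z ^+ 2 by rewrite sin2cos2.
have S1 : S 1%N.
  have [sX sY] := S0; split.
    have sN := sloped_coupling z S0.
    apply: sloped_ext (slopedM (slopedM sN sX) (sloped_cst P 2^-1)) _ _.
      by move=> p; rewrite orbit1.
    move=> m Pm.
    rewrite /ripple_amp /ripple_phase /drift_phase /phase_ratio !mul1r !mul0r cos0 sin0 cos_phiE //.
    have f2 : sin (phi z m) ^+ 2 = 1 - cosphi z m ^+ 2 by rewrite sin2cos2 cos_phiE.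
    have d0 : 1 - cosphi z m != 0 by rewrite subr_eq0 eq_sym lt_eqF //; case/andP: Pm.
    rewrite /drift_rate k; move: f2 d0; move: (sin (phi z m)) (cosphi z m) => f d f2 d0.
    split.
    - by field.
    - apply/eqP; rewrite -subr_eq0.
      rewrite [X in X == 0](_ : _ = 2^-1 *
          (2 * cos z - 2 * (2 * cos z ^+ 2 - 1 - d) / cos z) - cos z * d -
          (sin z ^+ 2 / cos z) * (f ^+ 2 / (1 - d))).
        by rewrite s2 f2; apply/eqP; field; rewrite c0 d0.
      by field; rewrite c0 d0.
    - apply/eqP; rewrite -subr_eq0.
      rewrite [X in X == 0](_ : _ = (2 - 2 * cos z ^+ 2 - 2 * sin z ^+ 2) / cos z).
        by rewrite s2; apply/eqP; field.
      by field; rewrite c0 s0.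
  apply: sloped_ext (slopedD
     (slopedD (sloped_cst P (sin z)) (slopedM (sloped_cst P (- sin z)) (sloped_fst P)))
     (slopedM (sloped_param P (@continuous_tilt z)) (sloped_snd P))) _ _.
    by move=> p; rewrite orbit1 /=; ring.
  move=> m Pm; rewrite /ripple_amp /ripple_phase /drift_phase /phase_ratio !mul1r cos_phiE //.
  have f2 : sin (phi z m) ^+ 2 = 1 - cosphi z m ^+ 2 by rewrite sin2cos2 cos_phiE.
  have d0 : 1 - cosphi z m != 0 by rewrite subr_eq0 eq_sym lt_eqF //; case/andP: Pm.
  rewrite /drift_rate /tilt k; move: f2 d0; move: (sin (phi z m)) (cosphi z m) => f d f2 d0.
  split.
  - by ring.
  - apply/eqP; rewrite -subr_eq0.
    rewrite [X in X == 0](_ : _ = sin z * (- 1 - d + f ^+ 2 / (1 - d))).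
      by rewrite f2; apply/eqP; field.
    by field; rewrite c0 d0.
  - apply/eqP; rewrite -subr_eq0.
    rewrite [X in X == 0](_ : _ = 2 * (sin z ^+ 2 + cos z ^+ 2 - 1) / sin z).
      by rewrite s2 subrK subrr mulr0 mul0r.
    by field; rewrite c0 s0.
suff H : S j /\ S j.+1 by case: H.
elim: j => [|j [Sj Sj1]]; first by split.
split=> //.
have e1 : j%:R * z = j.+1%:R * z - z by rewrite -natr1; ring.
have e2 : j.+2%:R * z = j.+1%:R * z + z by rewrite -[j.+2%:R]natr1; ring.
rewrite /S e1 in Sj; rewrite /S e2.
have := sloped_advance Sj Sj1 (fun m Pm => linear_ripple j c0 s0 Pm)
  (fun m _ => linear_drift m j c0 s0).
have X p : orbit z p j.+1 = ((orbit z p j.+1).1, (orbit z p j.+1).2) by case: (orbit z p j.+1).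
move=> [h1 h2]; split.
  by apply: sloped_ext h1 _ _ => // p; rewrite orbitSS -X.
by apply: sloped_ext h2 _ _ => // p; rewrite orbitSS -X.
Qed.

(** The orbit divided by the rotating wave, so that the wave is constant 1. *)
Definition corotating z p j : R * R :=
  (cos (j%:R * z) * (orbit z p j).1 + sin (j%:R * z) * (orbit z p j).2,
   cos (j%:R * z) * (orbit z p j).2 - sin (j%:R * z) * (orbit z p j).1).

Lemma sloped_corotating z j : cos z != 0 -> sin z != 0 ->
  sloped (elliptic z) (fun p => (corotating z p j).1) (fun=> 1) (ripple_amp z j) (fun=> 1) /\
  sloped (elliptic z) (fun p => (corotating z p j).2) (fun=> 0)
    (ripple_phase z j) (drift_phase z j).
Proof.
move=> c0 s0; have [sX sY] := sloped_orbit j c0 s0.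
set t := j%:R * z in sX sY *.
have c1 : cos t * cos t + sin t * sin t = 1 by rewrite -!expr2 cos2Dsin2.
have e a b : cos t * (cos t * a - sin t * b) + sin t * (sin t * a + cos t * b) = a.
  rewrite [LHS](_ : _ = (cos t * cos t + sin t * sin t) * a); last by ring.
  by rewrite c1 mul1r.
have e' a b : cos t * (sin t * a + cos t * b) - sin t * (cos t * a - sin t * b) = b.
  rewrite [LHS](_ : _ = (cos t * cos t + sin t * sin t) * b); last by ring.
  by rewrite c1 mul1r.
have sc := sloped_cst (elliptic z) (cos t); have ss := sloped_cst (elliptic z) (sin t).
split.
  apply: sloped_ext (slopedD (slopedM sc sX) (slopedM ss sY)) _ _ => // m _.
  by rewrite !mulr0 !addr0 !e.
apply: sloped_ext (slopedD (slopedM sc sY) (slopedN (slopedM ss sX))) _ _ => // m _.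
by rewrite !mulr0 !addr0 !e'; split=> //; ring.
Qed.

End Shooting.

(** * Relative equilibria and orbits *)

Section States.
Variable R : realType.
Implicit Types (z m : R) (p : R * R * R) (w : R * R).
Local Open Scope complex_scope.

Definition toC w : R[i] := w.1 +i* w.2.
Definition mirror w : R * R := (w.1, - w.2).

Lemma coupling_mirror z m w : coupling z m (mirror w) = coupling z m w.
Proof. by rewrite /coupling /= sqrrN. Qed.

(** The potential takes values in the interval from 0 (excluded) to 1, and
    2 cos z > 1. *)
Lemma coupling_gt0 z m w : 2^-1 < cos z -> 0 < coupling z m w.
Proof.
move=> cz; rewrite /coupling /saturable.
have h1 : 0 < (1 + m ^+ 2)^-1 by rewrite invr_gt0 onem2_gt0.
have h2 : (1 + m ^+ 2 * (w.1 ^+ 2 + w.2 ^+ 2))^-1 <= 1.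
  have : 0 <= m ^+ 2 * (w.1 ^+ 2 + w.2 ^+ 2) by rewrite mulr_ge0 ?addr_ge0 ?sqr_ge0.
  by move=> h; rewrite invf_le1; lra.
lra.
Qed.

(** Reversibility: the conjugate orbit run backwards from n = l + k satisfies the
    same second-order recurrence, so it is enough that the two agree at two
    consecutive sites. When l = k + 2 the second one is the midpoint k + 1, and
    the recurrence there forces its imaginary part to vanish. *)
Lemma mirror_orbit z p k l : 2^-1 < cos z -> orbit z p l = mirror (orbit z p k) ->
  l = k.+1 \/ l = k.+2 ->
  forall j, (j <= l + k)%N -> orbit z p (l + k - j) = mirror (orbit z p j).
Proof.
move=> cz lk d.
have inv w w' : w = mirror w' -> w' = mirror w.
  by move=> ->; case: w' => a b; rewrite /mirror /= opprK.
have mid : orbit z p l.-1 = mirror (orbit z p k.+1).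
  case: d => lE; rewrite lE /= in lk *; first exact: inv.
  have := lk; rewrite orbitSS /mirror => -[_ E].
  have {}E : coupling z p.2 (orbit z p k.+1) * (orbit z p k.+1).2 = 0 by lra.
  move/eqP: E; rewrite mulf_eq0 gt_eqF ?coupling_gt0 //= => /eqP E.
  by case: (orbit z p k.+1) E => a b /= ->; rewrite oppr0.
have l0 : (0 < l)%N by case: d => ->.
have main i : (i <= k)%N -> orbit z p (l + i) = mirror (orbit z p (k - i)) /\
    orbit z p (l + i).-1 = mirror (orbit z p (k - i).+1).
  elim: i => [|i IH] ik; first by rewrite addn0 subn0.
  have [h1 h2] := IH (ltnW ik).
  have e1 : (k - i)%N = (k - i.+1).+1 by lia.
  rewrite addnS /= h1 e1; split=> //.
  have [e2 e3] : (l + i).+1 = (l + i).-1.+2 /\ (l + i)%N = (l + i).-1.+1 by lia.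
  rewrite e2 orbitSS -e3 h1 h2 e1 coupling_mirror orbitSS /mirror /=.
  by congr pair; ring.
move=> j jlk; have [jk|jk] := leqP j k.
  have -> : (l + k - j)%N = (l + (k - j))%N by lia.
  have [h _] := main _ (leq_subr j k); rewrite h; congr (mirror (orbit z p _)); lia.
have [jl|jl] := leqP l j.
  have jk' : (j - l <= k)%N by lia.
  have [h _] := main _ jk'; rewrite subnKC // in h.
  by apply: inv; rewrite h; congr (mirror (orbit z p _)); lia.
have -> : j = k.+1 by lia.
by rewrite -mid; congr orbit; lia.
Qed.

Lemma site_equation n m w wl wr :
  ((frequency (@saturable R) n m)%:C * toC w
    + (saturable (Normc.normc (m%:C * toC w) ^+ 2))%:C * toC w
    + (toC wr - 2 * toC w + toC wl) = 0) <->
  wr.1 + wl.1 = coupling (zeta R n) m w * w.1 /\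
  wr.2 + wl.2 = coupling (zeta R n) m w * w.2.
Proof.
case: w wl wr => [x y] [xl yl] [xr yr]; rewrite /toC /=.
have -> : Normc.normc (m%:C * (x +i* y)) ^+ 2 = m ^+ 2 * (x ^+ 2 + y ^+ 2).
  rewrite /Normc.normc; simpc; rewrite sqr_sqrtr ?addr_ge0 ?sqr_ge0 //; ring.
have -> : frequency (@saturable R) n m = 2 - 2 * cos (zeta R n) - saturable (m ^+ 2).
  rewrite /frequency [in cos _](_ : zeta R n = zeta R n / 2 + zeta R n / 2); last by field.
  rewrite cosD -!expr2 cos2sin2; ring.
rewrite /coupling /=; move: (saturable _) (saturable _) (cos _) => h0 h c.
simpc; split=> [[e1 e2]|[e1 e2]].
  by split; lra.
by congr (_ +i* _); lra.
Qed.

Definition orbit_state (n : nat) p : state R n :=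
  [ffun j : 'Z_n => toC (orbit (zeta R n) p j)].

Lemma ltn_Zp (n : nat) (j : 'Z_n) : (1 < n)%N -> (j < n)%N.
Proof. by move=> n1; rewrite -[X in (_ < X)%N](Zp_cast n1) ltn_ord. Qed.

(** For d = 1 the twisted shift is the identity. *)
Lemma Efix1_reflection (n : nat) (x : state R n) : (1 < n)%N ->
  Efix 1 x <-> forall j, x (- j) = (x j)^*.
Proof.
move=> n1; split=> [fx j|fx g].
  have /ffunP /(_ (- j)) := fx _ (Dtilde_reflection R n 1).
  by rewrite ffunE opprK.
elim=> [|||g1 g2 _ H1 _ H2|g1 g2 _ H1 gK Kg] //=.
- apply/ffunP => j; rewrite ffunE divn1 pchar_Zp // addr0 divr1.
  by rewrite /cis cosN sinN mulr_natl cos2pi sin2pi oppr0 mul1r.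
- by apply/ffunP => j; rewrite ffunE fx conjcK.
- by rewrite H2 H1.
- by rewrite -[in LHS]H1 gK.
Qed.

(** The symmetry about n / 2 together with that about 0 gives period n, so the
    two sites 0 and n - 1 where the recurrence wraps around fit as well. *)
Lemma orbit_state_equilibrium n p : (1 < n)%N ->
  (forall j, (j <= n)%N ->
     orbit (zeta R n) p (n - j) = mirror (orbit (zeta R n) p j)) ->
  relative_equilibrium (@saturable R) (orbit_state n p) p.2 /\
  Efix 1 (orbit_state n p).
Proof.
move=> n1; set o := orbit (zeta R n) p => sym.
have nn : n%:R = 0 :> 'Z_n by rewrite pchar_Zp.
have xE k : (k <= n)%N -> orbit_state n p k%:R = toC (o k).
  rewrite leq_eqVlt ffunE val_Zp_nat // => /orP[/eqP->|kn]; last by rewrite modn_small.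
  rewrite modnn; congr toC; rewrite -/o -[in RHS](subn0 n) sym // /o /mirror /=.
  by rewrite oppr0.
split; last first.
  apply/Efix1_reflection => // j; have jn := ltn_Zp j n1.
  have -> : - j = (n - j)%:R by rewrite natrB ?(ltnW jn) // nn sub0r natr_Zp.
  rewrite -[j in RHS]natr_Zp !xE ?leq_subr ?(ltnW jn) // sym ?(ltnW jn) //.
move=> j; have jn := ltn_Zp j n1.
rewrite -[j]natr_Zp natr1 (xE j) ?(ltnW jn) // (xE j.+1) //.
case: (posnP j) => [j0|j0].
  rewrite j0 sub0r (_ : -1 = n.-1%:R); last first.
    by apply/eqP; rewrite -subr_eq0 -opprD oppr_eq0 addrC natr1 prednK ?nn // ltnW.
  rewrite xE ?leq_pred // -subn1 sym ?(ltnW n1) //; apply/site_equation.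
  by rewrite /o orbit1 /=; split; field.
have -> : (j : nat)%:R - 1 = j.-1%:R :> 'Z_n by rewrite -[in LHS](prednK j0) -natr1 addrK.
rewrite xE; last by apply: leq_trans (leq_pred _) (ltnW jn).
apply/site_equation; have := orbitSS (zeta R n) p j.-1.
rewrite (prednK j0) -/o => ->.
by split; rewrite /= subrK.
Qed.

(** Every symmetric relative equilibrium is found by the shooting, including those
    far from the wave. *)
Lemma equilibrium_orbit n (x : state R n) (al be m : R) : (1 < n)%N ->
  relative_equilibrium (@saturable R) x m -> Efix 1 x ->
  complex.Re (x 0) = 1 + al + be ->
  complex.Im (x 1) = sin (zeta R n) - sin (zeta R n) * al + tilt (zeta R n) m * be ->
  forall k : nat, x k%:R = toC (orbit (zeta R n) (al, be, m) k).
Proof.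
move=> n1 eqx /(Efix1_reflection _ n1) rx x0 x1.
set o := orbit _ _.
have toCE (c : R[i]) : c = toC (complex.Re c, complex.Im c) by case: c.
have h0 : x 0 = toC (o 0%N).
  rewrite [LHS]toCE; congr toC; rewrite x0 /o orbit0 /=; congr pair.
  have := rx 0; rewrite oppr0; case: (x 0) => a b [/= e]; lra.
have h1 : x 1 = toC (o 1%N).
  have := eqx 0; rewrite add0r sub0r rx h0 [x 1]toCE.
  rewrite (_ : (toC (complex.Re (x 1), complex.Im (x 1)))^* =
    toC (mirror (complex.Re (x 1), complex.Im (x 1)))) //.
  move=> /site_equation /= [e _]; congr toC; rewrite /o orbit1 /= x1.
  by congr pair; move: e; rewrite /o orbit0 /=; lra.
move=> k; suff [] : x k%:R = toC (o k) /\ x k.+1%:R = toC (o k.+1) by [].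
elim: k => [|k [hk hk1]]; first by [].
split=> //; have := eqx k.+1%:R.
have -> : k.+1%:R - 1 = k%:R :> 'Z_n by rewrite -natr1 addrK.
rewrite natr1 hk hk1 [x k.+2%:R]toCE => /site_equation /= [e1 e2].
by congr toC; rewrite /o orbitSS /=; congr pair; rewrite -?/o; lra.
Qed.

Lemma corotating_toC z p j : toC (corotating z p j) = cis (- (j%:R * z)) * toC (orbit z p j).
Proof.
rewrite /corotating /cis /toC cosN sinN /=; simpc; congr (_ +i* _); ring.
Qed.

(** The rotating wave satisfies a_l = conj a_k when l + k = n, so the mirror
    condition may be tested after division by the wave. *)
Lemma corotating_mirror z p (k l : nat) : (l + k)%:R * z = 2 * pi ->
  (corotating z p l).1 - (corotating z p k).1 = 0 ->
  (corotating z p l).2 + (corotating z p k).2 = 0 ->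
  orbit z p l = mirror (orbit z p k).
Proof.
move=> e; rewrite /corotating /=.
have -> : l%:R * z = - (k%:R * z) + pi *+ 2.
  by rewrite -[pi *+ 2]mulr_natl -e natrD; ring.
rewrite cosD2pi sinD2pi cosN sinN.
move: (k%:R * z) (orbit z p l) (orbit z p k) => t [a b] [a' b'] /= e1 e2.
have c1 := cos2Dsin2 t.
have h1 : a - a' = 0.
  rewrite -[LHS]mulr1 -c1 -[RHS](mulr0 (cos t)) -e1.
  by rewrite -[RHS]addr0 -[X in _ = _ + X](mulr0 (sin t)) -e2; ring.
have h2 : b + b' = 0.
  rewrite -[LHS]mulr1 -c1 -[RHS](mulr0 (cos t)) -e2.
  by rewrite -[RHS]subr0 -[X in _ = _ - X](mulr0 (sin t)) -e1; ring.
by rewrite /mirror /=; congr pair; lra.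
Qed.

End States.

(** * The spectrum at the rotating wave *)

Section Spectrum.
Variable R : realType.
Implicit Types (z m : R) (p : R * R * R).

Lemma cos_double z : cos (2 * z) = 2 * cos z ^+ 2 - 1.
Proof. by rewrite mulr_natl cos_mulr2n mulr_natl. Qed.

Lemma zeta_range n : (16 <= n)%N -> 0 < zeta R n <= pi / 8.
Proof.
move=> hn; have n16 : 16 <= n%:R :> R by rewrite ler_nat.
have n0 : 0 < n%:R :> R by lra.
have p0 := pi_gt0 R.
rewrite /zeta divr_gt0 ?mulr_gt0 //= ler_pdivrMr // mulrAC ler_pdivlMr //.
nra.
Qed.

Lemma sin_zeta_gt0 n : (16 <= n)%N -> 0 < sin (zeta R n).
Proof. by move=> /zeta_range zb; have p0 := pi_gt0 R; apply: sin_gt0_pi; lra. Qed.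

(** cos (4 zeta) >= 0 as zeta <= pi / 8; two half-angle steps give the bound. *)
Lemma cos_zeta_range n : (16 <= n)%N -> 23 / 25 < cos (zeta R n) < 1.
Proof.
move=> hn; have zb := zeta_range hn; have p0 := pi_gt0 R.
have c0 : 0 < cos (zeta R n) by apply: cos_gt0_pihalf; lra.
have c2 : 0 <= cos (2 * zeta R n) by apply: cos_ge0_pihalf; lra.
have c4 : 0 <= cos (2 * (2 * zeta R n)) by apply: cos_ge0_pihalf; lra.
rewrite !cos_double in c2 c4; apply/andP; split; last by rewrite -cos0 ltr_cos ?in_itv /=; lra.
have d7 : 7 / 10 <= 2 * cos (zeta R n) ^+ 2 - 1 by nra.
nra.
Qed.

Lemma sin_zeta_neq0 n : (16 <= n)%N -> sin (zeta R n) != 0.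
Proof. by move=> /sin_zeta_gt0 s0; rewrite gt_eqF. Qed.

Lemma cos_zeta_neq0 n : (16 <= n)%N -> cos (zeta R n) != 0.
Proof. by move=> /cos_zeta_range /andP[c0 _]; rewrite gt_eqF //; lra. Qed.

Lemma delta1E n : (16 <= n)%N ->
  delta1 R n = 2 * cos (zeta R n) - 1 - (cos (zeta R n))^-1.
Proof.
move=> hn; have /andP[c0 _] := cos_zeta_range hn.
have zz : zeta R n = 2 * (zeta R n / 2) by field.
have e : sin (zeta R n / 2) ^+ 2 = (1 - cos (zeta R n)) / 2.
  by rewrite [in RHS]zz cos_double sin2cos2; field.
by rewrite /delta1 e sin2cos2; field; rewrite gt_eqF //; lra.
Qed.

(** delta1 = (2 c^2 - c - 1) / c with c = cos zeta, which exceeds -1/4 when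
    c > 23/25. *)
Lemma delta1_range n : (16 <= n)%N -> - (1 / 4) < delta1 R n < 0.
Proof.
move=> hn; have /andP[c0 c1] := cos_zeta_range hn; rewrite delta1E //.
move: (cos _) c0 c1 => c c0 c1; have cp : 0 < c by lra.
rewrite [X in _ < X](_ : _ = (2 * c ^+ 2 - c - 1) / c); last by field; rewrite gt_eqF.
rewrite [X in X < 0](_ : _ = (2 * c ^+ 2 - c - 1) / c); last by field; rewrite gt_eqF.
rewrite ltr_pdivlMr // ltr_pdivrMr // mul0r; apply/andP; split; nra.
Qed.

Lemma kappa_sub m m' : kappa m - kappa m' =
  - ((m ^+ 2 - m' ^+ 2) * (1 - m ^+ 2 * m' ^+ 2)) /
    ((1 + m ^+ 2) ^+ 2 * (1 + m' ^+ 2) ^+ 2).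
Proof. by rewrite /kappa -!exprVn; field; rewrite !onem2_neq0. Qed.

(** kappa is invariant under m -> 1 / m, so its two preimages of a level are
    inverse to each other. The smaller one is a root of e (1 + a^2) = a with
    e^2 = D. *)
Lemma kappa_level (D : R) : 0 < D < 1 / 4 -> exists2 a : R, 0 < a < 1 &
  forall m, 0 < m -> kappa m = - D <-> m = a \/ m = a^-1.
Proof.
move=> /andP[D0 D4]; pose e := Num.sqrt D.
have e0 : 0 < e by rewrite sqrtr_gt0.
have eD : e ^+ 2 = D by rewrite sqr_sqrtr // ltW.
have e2 : e < 1 / 2 by nra.
pose r := Num.sqrt (1 - 4 * e ^+ 2).
have r0 : 0 <= r by exact: sqrtr_ge0.
have r2 : r ^+ 2 = 1 - 4 * e ^+ 2 by rewrite sqr_sqrtr //; nra.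
pose a := (1 - r) / (2 * e).
have a2e : a * (2 * e) = 1 - r by rewrite /a divfK // gt_eqF //; lra.
have a0 : 0 < a by rewrite divr_gt0; nra.
have a1 : a < 1 by rewrite ltr_pdivrMr; nra.
have ea : e * (1 + a ^+ 2) = a.
  apply: (mulfI (_ : 4 * e != 0)); first by rewrite gt_eqF //; lra.
  rewrite [LHS](_ : _ = 4 * e ^+ 2 + (a * (2 * e)) ^+ 2); last by ring.
  rewrite [RHS](_ : _ = 2 * (a * (2 * e))); last by ring.
  by rewrite a2e; nra.
have ka : kappa a = - D.
  have eE : e = a / (1 + a ^+ 2) by rewrite -[X in X / _]ea mulfK ?onem2_neq0.
  by rewrite /kappa mulNr -exprVn -exprMn -eE eD.
exists a; first by rewrite a0.
move=> m m0; split=> [km|].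
  have : kappa m - kappa a = 0 by rewrite km ka subrr.
  have dn : (1 + m ^+ 2) ^+ 2 * (1 + a ^+ 2) ^+ 2 != 0.
    by rewrite mulf_neq0 // expf_neq0 // onem2_neq0.
  rewrite kappa_sub => /eqP.
  rewrite mulf_eq0 invr_eq0 (negbTE dn) orbF oppr_eq0 mulf_eq0 => /orP[|] /eqP h.
    by left; nra.
  right; apply: (mulIf (_ : a != 0)); first by rewrite gt_eqF.
  rewrite mulVf ?gt_eqF //; have am : 0 < m * a by rewrite mulr_gt0.
  by move: h; rewrite -exprMn; nra.
move=> [->//|->]; rewrite -ka; apply/eqP; rewrite -subr_eq0 kappa_sub.
have -> : a^-1 ^+ 2 * a ^+ 2 = 1 by rewrite -exprMn mulVf ?expr1n // gt_eqF.
by rewrite subrr mulr0 oppr0 mul0r.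
Qed.

Lemma continuous_cosphi z : continuous (cosphi z).
Proof.
move=> m; apply: cvgB; first exact: cvg_cst.
by apply: cvgM; [exact: continuous_kappa|exact: cvg_cst].
Qed.

Lemma elliptic_near z m0 : elliptic z m0 ->
  exists2 d : R, 0 < d & forall m, `|m - m0| < d -> elliptic z m.
Proof.
move=> /andP[h1 h2].
pose e := Num.min (1 - cosphi z m0) (1 + cosphi z m0).
have e0 : 0 < e by rewrite lt_min; apply/andP; split; lra.
have [d d0 H] := continuous_ball (@continuous_cosphi z m0) e0.
exists d => // m hm; have := H m; rewrite /ball /= distrC => /(_ hm).
rewrite lt_min !ltr_norml /elliptic => /andP[/andP[? ?] /andP[? ?]].
by apply/andP; split; lra.
Qed.

Lemma phi_range z m : elliptic z m -> 0 < phi z m < pi.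
Proof.
by move=> /andP[h1 h2]; rewrite acos_gt0 ?acos_ltpi ?(ltW h1) ?(ltW h2) ?h1 ?h2.
Qed.

Lemma cosphi_at_bifurcation n m0 : (16 <= n)%N -> kappa m0 = delta1 R n ->
  cosphi (zeta R n) m0 = cos (zeta R n).
Proof.
move=> hn km; have /andP[c0 _] := cos_zeta_range hn.
by rewrite /cosphi km delta1E //; field; rewrite gt_eqF //; lra.
Qed.

Lemma phi_at_bifurcation n m0 : (16 <= n)%N -> kappa m0 = delta1 R n ->
  elliptic (zeta R n) m0 /\ phi (zeta R n) m0 = zeta R n.
Proof.
move=> hn km; have /andP[c0 c1] := cos_zeta_range hn.
rewrite /elliptic /phi cosphi_at_bifurcation // cosK; last first.
  by have := zeta_range hn; have := pi_gt0 R; rewrite in_itv /=; lra.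
by split=> //; apply/andP; split; lra.
Qed.

Lemma cosB_prod (x y : R) :
  cos x - cos y = - 2 * sin ((x + y) / 2) * sin ((x - y) / 2).
Proof.
transitivity (cos ((x + y) / 2 + (x - y) / 2) - cos ((x + y) / 2 - (x - y) / 2)).
  by congr (cos _ - cos _); field.
by rewrite cosD cosB; ring.
Qed.

Lemma kappa_lt0 m : m != 0 -> kappa m < 0.
Proof.
move=> m0; have m2 : 0 < m ^+ 2 by rewrite exprn_even_gt0.
by rewrite /kappa mulNr oppr_lt0 mulr_gt0 // invr_gt0 exprn_gt0 // onem2_gt0.
Qed.

(** The difference of cosines is -2 sin (n phi / 2) sin ((l - k) phi / 2). Since
    kappa < 0, phi < 2 zeta, so n phi / 2 stays below 2 pi and its sine changes
    sign only at pi, that is at phi = zeta. *)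
Lemma gap_sign n k l m : (16 <= n)%N -> (l + k = n)%N ->
  l = k.+1 \/ l = k.+2 -> elliptic (zeta R n) m -> m != 0 ->
  cosphi (zeta R n) m != cos (zeta R n) ->
  0 < (cos (zeta R n) - cosphi (zeta R n) m) *
    (ripple_amp (zeta R n) l m - ripple_amp (zeta R n) k m).
Proof.
move=> hn lkn lk el m0; have /andP[c0 c1] := cos_zeta_range hn.
have zb := zeta_range hn; have fb := phi_range el.
have p0 := pi_gt0 R; have n0 : 0 < n%:R :> R by rewrite ltr0n; apply: leq_trans hn.
have kl : (k <= l)%N by case: lk => ->; [exact: leqnSn|exact/leqW/leqnSn].
have dE : (l - k = 1)%N \/ (l - k = 2)%N.
  by case: lk => ->; [left|right]; rewrite ?subSnn // -addn2 addKn.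
have nz : n%:R * zeta R n = 2 * pi by rewrite /zeta mulrC divfK // gt_eqF.
have lt2 : phi (zeta R n) m < 2 * zeta R n.
  rewrite -ltr_cos ?in_itv /=; try lra.
  rewrite cos_phiE // cos_double /cosphi; have := kappa_lt0 m0; nra.
have cf := cos_phiE el.
have cmp x y : 0 < x < pi -> 0 < y < pi -> cos x < cos y -> y < x.
  by move=> hx hy; rewrite ltr_cos // in_itv /=; lra.
rewrite /ripple_amp cosB_prod -mulrDl -mulrBl -natrD lkn -natrB //.
have T0 : 0 < sin ((l - k)%:R * phi (zeta R n) m / 2).
  case: dE => ->; apply: sin_gt0_pi; lra.
move: T0; move: (sin ((l - k)%:R * _ / 2)) => T T0.
rewrite -cf neq_lt => /orP[] lt.
  have {}lt : zeta R n < phi (zeta R n) m by apply: cmp => //; lra.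
  have S0 : 0 < sin (n%:R * phi (zeta R n) m / 2 - pi) by apply: sin_gt0_pi; nra.
  rewrite [X in _ < X](_ : _ = 2 * (sin (n%:R * phi (zeta R n) m / 2 - pi) * T *
      (cos (zeta R n) - cos (phi (zeta R n) m)))).
    by rewrite !mulr_gt0 // subr_gt0 ltr_cos // in_itv /=; lra.
  by rewrite sinB cospi sinpi; ring.
have {}lt : phi (zeta R n) m < zeta R n by apply: cmp => //; lra.
have S0 : 0 < sin (n%:R * phi (zeta R n) m / 2) by apply: sin_gt0_pi; nra.
rewrite [X in _ < X](_ : _ = 2 * (sin (n%:R * phi (zeta R n) m / 2) * T *
    (cos (phi (zeta R n) m) - cos (zeta R n)))).
  by rewrite !mulr_gt0 // subr_gt0 ltr_cos // in_itv /=; lra.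
by ring.
Qed.

(** kappa is strictly monotone on each side of 1; the margin e keeps both test
    points positive and on the same side of 1 as m0. *)
Lemma kappa_crossing m0 d : 0 < m0 -> m0 != 1 -> 0 < d -> exists m1 m2,
  [/\ 0 < m1 < m2, `|m1 - m0| < d, `|m2 - m0| < d &
      (kappa m1 - kappa m0) * (kappa m2 - kappa m0) < 0].
Proof.
move=> m00 m01 d0; pose e := Num.min d (Num.min m0 `|1 - m0|) / 2.
have n0 : 0 < `|1 - m0| by rewrite normr_gt0 subr_eq0 eq_sym.
have e0 : 0 < e by rewrite divr_gt0 // !lt_min d0 m00.
have : 2 * e <= Num.min d (Num.min m0 `|1 - m0|) by rewrite /e; lra.
rewrite !le_min => /and3P[ed em en]; clearbody e.
exists (m0 - e), (m0 + e); split.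
- by apply/andP; split; lra.
- by rewrite ltr_norml; lra.
- by rewrite ltr_norml; lra.
have dn (x : R) : 0 < (1 + x ^+ 2) ^+ 2 by rewrite exprn_gt0 // onem2_gt0.
have s1 : (m0 - e) ^+ 2 - m0 ^+ 2 < 0.
  rewrite subr_lt0 ltr_pXn2r // ?nnegrE; lra.
have s2 : 0 < (m0 + e) ^+ 2 - m0 ^+ 2.
  rewrite subr_gt0 ltr_pXn2r // ?nnegrE; lra.
have s3 : 0 < (1 - (m0 - e) ^+ 2 * m0 ^+ 2) * (1 - (m0 + e) ^+ 2 * m0 ^+ 2).
  rewrite -!exprMn; have [m1|m1] := ltP m0 1.
    have en' : 2 * e <= 1 - m0 by rewrite -(gtr0_norm (_ : 0 < 1 - m0)) //; lra.
    by rewrite mulr_gt0 // subr_gt0 exprn_ilt1 ?mulr_ge0 //; nra.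
  have {}m1 : 1 < m0 by rewrite lt_neqAle eq_sym m01.
  have en' : 2 * e <= m0 - 1 by rewrite -opprB -(ltr0_norm (_ : 1 - m0 < 0)) //; lra.
  by rewrite nmulr_rgt0 // subr_lt0 exprn_egt1 //; nra.
rewrite !kappa_sub.
rewrite [X in X < 0](_ : _ = ((m0 - e) ^+ 2 - m0 ^+ 2) * (((m0 + e) ^+ 2 - m0 ^+ 2) *
   ((1 - (m0 - e) ^+ 2 * m0 ^+ 2) * (1 - (m0 + e) ^+ 2 * m0 ^+ 2)) /
   ((1 + (m0 - e) ^+ 2) ^+ 2 * (1 + m0 ^+ 2) ^+ 2 *
    ((1 + (m0 + e) ^+ 2) ^+ 2 * (1 + m0 ^+ 2) ^+ 2)))); last first.
  by field; rewrite !onem2_neq0.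
rewrite nmulr_rlt0 //; apply: divr_gt0; first exact: mulr_gt0.
have := dn (m0 - e); have := dn (m0 + e); have := dn m0.
move=> h1 h2 h3; apply: mulr_gt0; apply: mulr_gt0 => //.
Qed.

(** The drift accumulates a phase over one period: it cannot close up. *)
Lemma drift_rate_bif_lt0 n m0 : (16 <= n)%N -> kappa m0 = delta1 R n ->
  drift_rate (zeta R n) m0 < 0.
Proof.
move=> hn km; have /andP[c0 c1] := cos_zeta_range hn; have s0 := sin_zeta_gt0 hn.
rewrite /drift_rate cosphi_at_bifurcation //.
rewrite [X in X < 0](_ : _ = (1 - cos (zeta R n) - 2 * sin (zeta R n) ^+ 2) /
    (sin (zeta R n) * cos (zeta R n))).
  rewrite ltr_pdivrMr ?mulr_gt0 //; last by lra.
  by rewrite mul0r sin2cos2; nra.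
by field; rewrite !gt_eqF //; lra.
Qed.

End Spectrum.

(** * The bifurcation *)

Section Main.
Variable R : realType.
Implicit Types (z m : R) (p : R * R * R) (w : R * R).
Local Open Scope complex_scope.

Lemma uniform_radius (Q : nat -> R -> Prop) N :
  (forall j d d', d' <= d -> Q j d -> Q j d') ->
  (forall j, exists2 d : R, 0 < d & Q j d) ->
  exists2 d : R, 0 < d & forall j, (j < N)%N -> Q j d.
Proof.
move=> anti ex; elim: N => [|N [d d0 H]]; first by exists 1.
have [d' d'0 H'] := ex N; exists (Num.min d d'); first by rewrite lt_min d0.
move=> j; rewrite ltnS leq_eqVlt => /orP[/eqP->|jN].
  by apply: anti H'; rewrite ge_min lexx orbT.
by apply: anti (H _ jN); rewrite ge_min lexx.
Qed.

Lemma normc_le_abs (u v : R) : Normc.normc (u +i* v) <= `|u| + `|v|.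
Proof.
rewrite /Normc.normc -[leRHS]ger0_norm ?addr_ge0 // -sqrtr_sqr ler_wsqrtr //.
rewrite sqrrD !real_normK ?num_real // -addrA lerD2l lerDr.
by rewrite mulrn_wge0 // mulr_ge0.
Qed.

Lemma abs_Re_le_normc (c : R[i]) : `|complex.Re c| <= Normc.normc c.
Proof.
by case: c => u v; rewrite /Normc.normc -sqrtr_sqr ler_wsqrtr // lerDl sqr_ge0.
Qed.

Lemma abs_Im_le_normc (c : R[i]) : `|complex.Im c| <= Normc.normc c.
Proof.
by case: c => u v; rewrite /Normc.normc -sqrtr_sqr ler_wsqrtr // lerDr sqr_ge0.
Qed.

Lemma orbit_trivial n m (j : nat) : (16 <= n)%N -> elliptic (zeta R n) m ->
  orbit (zeta R n) (0, 0, m) j = (cos (j%:R * zeta R n), sin (j%:R * zeta R n)).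
Proof.
move=> hn el; have cn := cos_zeta_neq0 R hn; have sn := sin_zeta_neq0 R hn.
have [[g [h [_ _ _ _ H]]] [g' [h' [_ _ _ _ H']]]] := sloped_orbit j cn sn.
by rewrite [LHS]surjective_pairing; congr pair; [case: (H _ el)|case: (H' _ el)].
Qed.

(** Continuity of finitely many sites of the orbit in the parameters. *)
Lemma orbit_near_wave n m0 eps : (16 <= n)%N -> elliptic (zeta R n) m0 ->
  0 < eps -> exists2 d : R, 0 < d & forall al be m,
    `|al| < d -> `|be| < d -> `|m - m0| < d ->
    near_wave m0 eps (orbit_state n (al, be, m)) m.
Proof.
move=> hn el e0; have cn := cos_zeta_neq0 R hn; have sn := sin_zeta_neq0 R hn.
have e20 : 0 < eps / 2 by rewrite divr_gt0.
pose Q (j : nat) (d : R) := forall al be m, `|al| < d -> `|be| < d -> `|m - m0| < d ->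
  Normc.normc (toC (orbit (zeta R n) (al, be, m) j) - cis (j%:R * zeta R n)) < eps.
have [||d d0 H] := @uniform_radius Q n.
- move=> j d d' dd H al be m h1 h2 h3.
  by apply: H; apply: lt_le_trans dd.
- move=> j; have [[g [h [cX _ _ _ _]]] [g' [h' [cY _ _ _ _]]]] := sloped_orbit j cn sn.
  have [d1 d10 H1] := continuous_ball (cX (0, 0, m0)) e20.
  have [d2 d20 H2] := continuous_ball (cY (0, 0, m0)) e20.
  exists (Num.min d1 d2); first by rewrite lt_min d10.
  move=> al be m; rewrite !lt_min => /andP[a1 a2] /andP[b1 b2] /andP[m1 m2].
  have {H1} : `|(orbit (zeta R n) (al, be, m) j).1 - cos (j%:R * zeta R n)| < eps / 2.
    have := H1 (al, be, m); rewrite orbit_trivial //; apply.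
    by split; [split|] => /=; rewrite /ball /= ?sub0r ?normrN // distrC.
  have {H2} : `|(orbit (zeta R n) (al, be, m) j).2 - sin (j%:R * zeta R n)| < eps / 2.
    have := H2 (al, be, m); rewrite orbit_trivial //; apply.
    by split; [split|] => /=; rewrite /ball /= ?sub0r ?normrN // distrC.
  move: (orbit _ _ _) => [x y] /= h2 h1; rewrite /toC /cis /=; simpc.
  by apply: le_lt_trans (normc_le_abs _ _) _; lra.
exists (Num.min d eps); first by rewrite lt_min d0.
move=> al be m; rewrite !lt_min => /andP[a1 _] /andP[b1 _] /andP[m1 m2].
split=> // j; rewrite !ffunE; apply: H => //; apply: ltn_Zp; exact: leq_trans hn.
Qed.

(** The two equations say that x_l = conj x_k for the pair of sites around the
    midpoint n / 2. *)
Lemma bifurcating_branch n m0 : (16 <= n)%N -> 0 < m0 -> m0 != 1 ->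
  kappa m0 = delta1 R n -> forall eps, 0 < eps ->
  exists (x : state R n) (m : R),
    nontrivial_symmetric_equilibrium (@saturable R) x m /\ near_wave m0 eps x m.
Proof.
move=> hn m00 m01 km eps eps0; set z := zeta R n.
have /andP[c0 _] := cos_zeta_range R hn.
have cn := cos_zeta_neq0 R hn; have sn := sin_zeta_neq0 R hn.
have [el ph] := phi_at_bifurcation hn km.
(* l - k is 1 for n odd and 2 for n even. *)
pose k := n.-1./2; pose l := (n - k)%N.
have lkn : (l + k = n)%N by rewrite /l /k; lia.
have lk : l = k.+1 \/ l = k.+2 by rewrite /l /k; lia.
clearbody k l.
have nz : (l + k)%:R * z = 2 * pi.
  by rewrite lkn /z /zeta mulrC divfK // pnatr_eq0; lia.
have [sl1 sl2] := sloped_corotating l cn sn; have [sk1 sk2] := sloped_corotating k cn sn.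
have sF1 : sloped (elliptic z) (fun p => (corotating z p l).1 - (corotating z p k).1)
    (fun=> 0) (fun m => ripple_amp z l m - ripple_amp z k m) (fun=> 0).
  apply: sloped_ext (slopedD sl1 (slopedN sk1)) _ _ => // m _.
  by rewrite !subrr.
(* The sign makes the derivative along the drift positive. *)
have sF2 : sloped (elliptic z) (fun p => - ((corotating z p l).2 + (corotating z p k).2))
    (fun=> 0) (fun m => - (ripple_phase z l m + ripple_phase z k m))
    (fun m => - (drift_phase z l m + drift_phase z k m)).
  apply: sloped_ext (slopedN (slopedD sl2 sk2)) _ _ => // m _.
  by rewrite addr0 oppr0.
have [dP dP0 HP] := elliptic_near el.
have a20 : - (ripple_phase z l m0 + ripple_phase z k m0) = 0.
  rewrite /ripple_phase ph -/z -mulrDr.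
  have -> : l%:R * z = - (k%:R * z) + pi *+ 2.
    by rewrite -[pi *+ 2]mulr_natl -nz natrD; ring.
  by rewrite sinD2pi sinN addNr mulr0 oppr0.
have b20 : 0 < - (drift_phase z l m0 + drift_phase z k m0).
  rewrite /drift_phase -mulrDl -natrD lkn oppr_gt0 pmulr_rlt0; last by rewrite ltr0n; lia.
  exact: drift_rate_bif_lt0.
have cross d : 0 < d -> exists m1 m2, [/\ m1 < m2, `|m1 - m0| < d, `|m2 - m0| < d &
    (ripple_amp z l m1 - ripple_amp z k m1) * (ripple_amp z l m2 - ripple_amp z k m2) < 0].
  move=> d0; have d'0 : 0 < Num.min d dP by rewrite lt_min d0.
  have [m1 [m2 [/andP[m10 m12] h1 h2 hk]]] := kappa_crossing m00 m01 d'0.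
  move: h1 h2; rewrite !lt_min => /andP[h1 /HP e1] /andP[h2 /HP e2].
  exists m1, m2; split=> //.
  have gE m : cos z - cosphi z m = (kappa m - kappa m0) * cos z.
    by rewrite /z -[in LHS](cosphi_at_bifurcation hn km) /cosphi; ring.
  have ne m : kappa m - kappa m0 != 0 -> cosphi z m != cos z.
    by move=> h; rewrite eq_sym -subr_eq0 gE mulf_neq0.
  have n1 : kappa m1 - kappa m0 != 0 by apply: contraTneq hk => ->; rewrite mul0r ltxx.
  have n2 : kappa m2 - kappa m0 != 0 by apply: contraTneq hk => ->; rewrite mulr0 ltxx.
  have g1 := gap_sign hn lkn lk e1 (lt0r_neq0 m10) (ne _ n1).
  have g2 := gap_sign hn lkn lk e2 (lt0r_neq0 (lt_trans m10 m12)) (ne _ n2).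
  have := mulr_gt0 g1 g2; rewrite -/z !gE mulrACA => g.
  rewrite -(nmulr_rgt0 _ (_ : (kappa m1 - kappa m0) * cos z *
    ((kappa m2 - kappa m0) * cos z) < 0)) //.
  by rewrite mulrACA nmulr_rlt0 // mulr_gt0 // /z; lra.
have [d d0 Hd] := orbit_near_wave hn el eps0.
have [al [be [m [/andP[al0 ald] bed md F1 F2]]]] :=
  bifurcation_simple sF1 sF2 (ex_intro2 _ _ dP dP0 HP) a20 b20 cross d0.
have lm : orbit z (al, be, m) l = mirror (orbit z (al, be, m) k).
  by apply: corotating_mirror nz F1 _; apply/eqP; rewrite -oppr_eq0 F2.
have c2 : 2^-1 < cos z by rewrite /z; lra.
have sym := mirror_orbit c2 lm lk; rewrite lkn in sym.
have n1 : (1 < n)%N by apply: leq_trans hn.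
have [eqx fx] := orbit_state_equilibrium n1 sym.
exists (orbit_state n (al, be, m)), m; split; last first.
  by apply: Hd; rewrite ?(gtr0_norm al0) //; apply: lt_trans bed _; lra.
split=> // /ffunP /(_ 0); rewrite !ffunE /= orbit0 /cis /toC /= mul0r cos0 => -[] e _.
by move: bed; rewrite ltr_norml => /andP[]; lra.
Qed.

(** The hypothesis on the orbit is the invariance under the twisted shift, read at
    site 0: the orbit divided by the wave takes the same value at 0 and n / q.
    The ripple violates this at first order in its real part, since
    cos (zeta n / q) < 1, and the drift in its imaginary part. *)
Lemma no_higher_symmetry n m0 (q : nat) : (16 <= n)%N ->
  kappa m0 = delta1 R n -> (1 < q)%N -> (q %| n)%N ->
  exists2 d : R, 0 < d & forall al be m, `|al| < d -> `|be| < d -> `|m - m0| < d ->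
    toC (orbit (zeta R n) (al, be, m) 0) =
    cis (- (2 * pi / q%:R)) * toC (orbit (zeta R n) (al, be, m) (n %/ q)) ->
    al = 0 /\ be = 0.
Proof.
move=> hn km q1 qn; set z := zeta R n; set l := (n %/ q)%N.
have cn := cos_zeta_neq0 R hn; have sn := sin_zeta_neq0 R hn.
have [el ph] := phi_at_bifurcation hn km.
have q0 : q%:R != 0 :> R by rewrite pnatr_eq0; lia.
have lq : (l * q = n)%N by rewrite divnK.
have n0 : (0 < n)%N by apply: leq_trans hn.
have l0 : (0 < l)%N by rewrite divn_gt0 ?(dvdn_leq n0 qn) // (ltnW q1).
have lz : l%:R * z = 2 * pi / q%:R.
  by rewrite /z /zeta -lq natrM; field; rewrite q0 pnatr_eq0 -lt0n l0.
have [sl1 sl2] := sloped_corotating l cn sn; have [sk1 sk2] := sloped_corotating 0 cn sn.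
have sF1 : sloped (elliptic z) (fun p => (corotating z p l).1 - (corotating z p 0).1)
    (fun=> 0) (fun m => ripple_amp z l m - ripple_amp z 0 m) (fun=> 0).
  apply: sloped_ext (slopedD sl1 (slopedN sk1)) _ _ => // m _.
  by rewrite !subrr.
have a10 : ripple_amp z l m0 - ripple_amp z 0 m0 != 0.
  rewrite /ripple_amp ph -/z lz mul0r cos0 subr_eq0 lt_eqF // -[X in _ < X]cos0.
  have q2 : 2 <= q%:R :> R by rewrite ler_nat.
  have p0 := pi_gt0 R; have qp : 0 < q%:R :> R by lra.
  have lp : 2 * pi / q%:R <= pi :> R by rewrite ler_pdivrMr //; nra.
  have gp : 0 < 2 * pi / q%:R :> R by rewrite divr_gt0 // mulr_gt0.
  by rewrite ltr_cos ?in_itv /=; lra.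
have b20 : drift_phase z l m0 != 0.
  by rewrite /drift_phase mulf_neq0 ?(lt_eqF (drift_rate_bif_lt0 hn km)) // pnatr_eq0 -lt0n.
have [d d0 H] := isolated_zero sF1 sl2 (elliptic_near el) a10 b20.
exists d => // al be m h1 h2 h3 e.
have {e} : toC (corotating z (al, be, m) l) = toC (orbit z (al, be, m) 0).
  by rewrite corotating_toC lz.
rewrite orbit0 /toC => -[e1 e2]; apply: (H al be m) => //.
by rewrite /corotating /= e1 mul0r cos0 sin0 mul1r mulr0 addr0 subrr.
Qed.

(** For the second half, a symmetric equilibrium near the wave is an orbit whose
    parameters are recovered from x_0 and Im x_1 by inverting a linear system of
    determinant sin z + tilt z m, close to (1 - cos z) / sin z > 0; they are
    therefore small, and vanish by no_higher_symmetry. *)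
Lemma bifurcation_at n m0 : (16 <= n)%N -> 0 < m0 -> m0 != 1 ->
  kappa m0 = delta1 R n ->
  bifurcation_with_maximal_symmetry_D1 (@saturable R) n m0.
Proof.
move=> hn m00 m01 km; split; first exact: bifurcating_branch.
have n1 : (1 < n)%N by apply: leq_trans hn.
set z := zeta R n.
have /andP[c0 c1] := cos_zeta_range R hn; have s0 := sin_zeta_gt0 R hn.
have [el ph] := phi_at_bifurcation hn km.
have [dP dP0 HP] := elliptic_near el.
pose Q (q : nat) (d : R) := (1 < q)%N -> (q %| n)%N ->
  forall al be m, `|al| < d -> `|be| < d -> `|m - m0| < d ->
    toC (orbit (zeta R n) (al, be, m) 0) =
    cis (- (2 * pi / q%:R)) * toC (orbit (zeta R n) (al, be, m) (n %/ q)) ->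
    al = 0 /\ be = 0.
(* One radius for the finitely many divisors of n. *)
have [||d d0 Hd] := @uniform_radius Q n.+1.
- move=> q d d' dd H q1 qn al be m h1 h2 h3.
  by apply: H => //; apply: lt_le_trans dd.
- move=> q; have [q1|q1] := ltnP 1 q; last by exists 1 => // h; lia.
  have [qn|qn] := boolP (q %| n)%N; last by exists 1 => // _; rewrite (negbTE qn).
  by have [d d0 H] := no_higher_symmetry hn km q1 qn; exists d => // _ _; exact: H.
pose g := (1 - cos z) / sin z.
have g0 : 0 < g by rewrite divr_gt0 // subr_gt0.
have tg : sin z + tilt z m0 = g.
  rewrite /tilt km delta1E // -/z /g.
  rewrite [LHS](_ : _ = (2 * sin z ^+ 2 + (2 * cos z ^+ 2 - cos z - 1)) / sin z).
    by rewrite sin2cos2; congr (_ / _); ring.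
  by field; rewrite !gt_eqF //; rewrite /z; lra.
have g20 : 0 < g / 2 by lra.
have [dt dt0 Ht] := continuous_ball (@continuous_tilt R z m0) g20.
(* |be| <= 4 eps / g and |al| <= eps + |be|, so both are below K eps. *)
pose K := 1 + 4 / g.
have K0 : 0 < K by apply: addr_gt0 => //; apply: divr_gt0.
pose eps := Num.min (Num.min dP dt) (Num.min d (d / K)).
have dK0 : 0 < d / K by apply: divr_gt0.
have eps0 : 0 < eps by rewrite !lt_min dP0 dt0 d0.
exists eps => //.
move=> x m [eqx fx xw] [xnear mnear] q q1 qn fq.
have mP : elliptic z m by apply: HP; move: mnear; rewrite !lt_min => /andP[/andP[]].
have md : `|m - m0| < d by move: mnear; rewrite !lt_min => /andP[_ /andP[]].
have eK : eps * K <= d by rewrite -ler_pdivlMr // !ge_min lexx !orbT.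
have gm : g / 2 < sin z + tilt z m.
  have := Ht m; rewrite /ball /= distrC => h.
  have /h : `|m - m0| < dt by move: mnear; rewrite !lt_min => /andP[/andP[]].
  by rewrite ltr_norml => /andP[] *; lra.
clearbody eps.
have x0 : `|complex.Re (x 0) - 1| < eps.
  have := le_lt_trans (abs_Re_le_normc _) (xnear 0); rewrite ffunE /cis mul0r cos0.
  by case: (x 0).
have x1 : `|complex.Im (x 1) - sin z| < eps.
  have := le_lt_trans (abs_Im_le_normc _) (xnear 1); rewrite ffunE.
  have -> : nat_of_ord (1 : 'Z_n) = 1%N by rewrite -[1]/(1%:R) val_Zp_nat // modn_small.
  by rewrite /cis; case: (x 1) => a b /=; rewrite mul1r.
pose be := ((complex.Im (x 1) - sin z) + sin z * (complex.Re (x 0) - 1)) /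
  (sin z + tilt z m).
pose al := complex.Re (x 0) - 1 - be.
have gm0 : 0 < sin z + tilt z m by lra.
have beE : be * (sin z + tilt z m) =
    (complex.Im (x 1) - sin z) + sin z * (complex.Re (x 0) - 1).
  by rewrite /be divfK // gt_eqF.
have orb := @equilibrium_orbit R n x al be m n1 eqx fx.
have {}orb := orb (_ : complex.Re (x 0) = 1 + al + be).
have {}orb := orb ltac:(rewrite /al; ring).
have {}orb : forall k : nat, x k%:R = toC (orbit z (al, be, m) k).
  by apply: orb; rewrite -/z /al; move: beE; lra.
have be4 : `|be| * g <= 4 * eps.
  have : `|be| * (sin z + tilt z m) <= 2 * eps.
    rewrite -[X in _ * X](gtr0_norm gm0) -normrM beE.
    apply: le_trans (ler_normD _ _) _; rewrite normrM (gtr0_norm s0).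
    have := sin_le1 z; have := normr_ge0 (complex.Re (x 0) - 1); nra.
  have := normr_ge0 be; nra.
have be4' : `|be| <= eps * (4 / g) by rewrite mulrA ler_pdivlMr // [eps * 4]mulrC.
have bed : `|be| < d.
  by apply: le_lt_trans be4' _; apply: lt_le_trans eK; rewrite /K mulrDr; lra.
have ald : `|al| < d.
  apply: le_lt_trans (ler_normB _ _) _; apply: lt_le_trans eK.
  by rewrite /K mulrDr mulr1; apply: ltr_leD.
have shift : toC (orbit z (al, be, m) 0) =
    cis (- (2 * pi / q%:R)) * toC (orbit z (al, be, m) (n %/ q)).
  have /ffunP /(_ 0) := fq _ (Dtilde_shift R n q).
  by rewrite ffunE add0r orb => ->; rewrite -orb.
have qN : (q < n.+1)%N by rewrite ltnS; apply: dvdn_leq qn; apply: leq_trans hn.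
have [a0 b0] := Hd q qN q1 qn _ _ _ ald bed md shift.
apply: xw; apply/ffunP => j; rewrite ffunE -[in LHS](natr_Zp j) orb a0 b0.
by rewrite orbit_trivial.
Qed.

End Main.

Theorem theorem40 (R : realType) (n : nat) (hn : (16 <= n)%N) :
  exists mu_minus mu_plus : R,
    [/\ 0 < mu_minus < 1,
        1 < mu_plus,
        forall mu : R, 0 < mu ->
          (- mu ^+ 2 * (1 + mu ^+ 2) ^- 2 = delta1 R n <->
           mu = mu_minus \/ mu = mu_plus),
        bifurcation_with_maximal_symmetry_D1 (@saturable R) n mu_minus
      & bifurcation_with_maximal_symmetry_D1 (@saturable R) n mu_plus].
Proof.
have /andP[D4 D0] := delta1_range R hn.
have [|a /andP[a0 a1] ha] := @kappa_level R (- delta1 R n); first by apply/andP; split; lra.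
rewrite opprK in ha; exists a, a^-1.
have ai1 : 1 < a^-1 by rewrite invf_gt1.
have ai0 : 0 < a^-1 by rewrite invr_gt0.
split=> //; first by rewrite a0.
  by apply: bifurcation_at; rewrite ?lt_eqF //; apply/ha; [|left].
by apply: bifurcation_at; rewrite ?gt_eqF //; apply/ha; [|right].
Qed.
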